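(* Let $m\ge9$ and let $c_0>0$. Let $\Delta=\sum_{k=1}^s\Delta_ke^{\mathrm i\theta_k}\delta_{T_k}$ be a discrete measure on $\mathbb T=[-1,1]$ whose support $\mathbf S=\{T_1,\dots,T_s\}$ is at distance at least $2c_0$ from the endpoints $\pm1$. Assume that $\mathbf S$ satisfies $\mathrm{QIC}(C_a,C_b)$ with $C_b/C_a\le c_0^2$. Let $y=\int\Phi\,d\Delta+\varepsilon$ be the noisy Chebyshev moment samples with Gaussian noise of standard deviation $\sigma>0$, and let $\hat\Delta$ be a solution to the BLASSO problem with tuning parameter $\lambda$ such that $$\lambda\ge\lambda_M:=\sigma\sqrt{6m\log m}.$$ Then, with probability greater than $$1-8\,\frac{\lambda}{\lambda_M}\sqrt{\log m}\,\exp\Big[-\Big(2\frac{\lambda^2}{\lambda_M^2}-1\Big)\log m\Big],$$ the following holds. (i) For every $x\in[-1,1]$ such that $|\hat\Delta(\{x\})|>\frac{2\lambda}{C_b}$, there exists a unique $T\in\mathbf S$ satisfying $$|x-T|\le\Big[\frac{2\lambda}{C_a|\hat\Delta(\{x\})|}\Big]^{1/2}\frac1m\le\frac{c_0}{m}.$$ (ii) Let $C'=2+\max\big\{\frac{2(1-C_b)}{C_b},\frac{4}{C_a-C_b}\big\}$. For every $T_j\in\mathbf S$ with $\Delta_j>C'\lambda$, there exists $\hat T\in\mathrm{Supp}(\hat\Delta)$ satisfying $$|T_j-\hat T|\le\Big[\frac{2\lambda}{C_a(\Delta_j-C'\lambda)}\Big]^{1/2}\frac1m.$$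
   Context: Setting. $\mathbb T=[-1,1]$ with the usual distance. $\varphi_0=1$ and, for $1\le k\le m$, $\varphi_k(x)=\sqrt2\cos(k\arccos x)$ (i.e. $\sqrt2$ times the $k$-th Chebyshev polynomial of the first kind). $\mathbf F=\{\varphi_0,\dots,\varphi_m\}$ is orthonormal with respect to the probability measure $\frac1\pi(1-t^2)^{-1/2}dt$ on $[-1,1]$. $\Phi=(\varphi_0,\dots,\varphi_m)$, and $\mathrm{Span}(\mathbf F)$ is the complex span. The target is $\Delta=\sum_{k=1}^s\Delta_ke^{\mathrm i\theta_k}\delta_{T_k}$ with $\Delta_k>0$, $\theta_k\in\mathbb R$ and $T_k\in\mathbb T$ distinct. Noise: $\varepsilon=(\varepsilon_0,\dots,\varepsilon_m)$ with $\varepsilon_k$ i.i.d. centered Gaussian with standard deviation $\sigma$. One observes $y=\int_{\mathbb T}\Phi\,d\Delta+\varepsilon$. BLASSO with parameter $\lambda$: $\hat\Delta\in\arg\min_\mu\frac12\big\|\int_{\mathbb T}\Phi\,d\mu-y\big\|_2^2+\lambda\|\mu\|_{TV}$, where the minimum is over all finite complex measures on $\mathbb T$ and $\|\cdot\|_{TV}$ is the total variation norm. The solution $\hat\Delta$ is taken to be finitely atomic. Quadratic isolation condition. A finite set $\mathbf S=\{T_1,\dots,T_s\}\subset\mathbb T$ satisfies $\mathrm{QIC}(C_a,C_b)$, where $C_a>0$ and $0<C_b<1$, if for all $(\theta_k)_{k=1}^s\in\mathbb R^s$ there exists $P\in\mathrm{Span}(\mathbf F)$ such that $P(T_k)=e^{-\mathrm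 i\theta_k}$ for all $k$ and, for all $x\in\mathbb T$, $1-|P(x)|\ge\min_{T\in\mathbf S}\min\{C_am^2|x-T|^2,\,C_b\}$. *)

(* Defs.v *)
From HB Require Import structures.
From mathcomp Require Import all_boot all_order all_algebra.
From mathcomp Require Import complex.
From mathcomp Require Import all_classical all_reals all_analysis.

Set Implicit Arguments.
Unset Strict Implicit.
Unset Printing Implicit Defensive.
Import Order.TTheory GRing.Theory Num.Theory.
Import numFieldNormedType.Exports.
Import Normc.

Local Open Scope classical_set_scope.
Local Open Scope ring_scope.
Local Open Scope complex_scope.

Definition expi (R : realType) (t : R) : R[i] := cos t +i* sin t.

(* A charge is a finite signed measure, so a finite complex measure is exactly
   a pair of charges; everything lives on the Borel sets of R, and measures on
   [-1, 1] are those vanishing outside [-1, 1]. *)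
Record cmeasure (R : realType) := CMeasure {
  cm_re : {charge set R -> \bar R};
  cm_im : {charge set R -> \bar R} }.

Definition cval (R : realType) (mu : cmeasure R) (A : set R) : R[i] :=
  fine (cm_re mu A) +i* fine (cm_im mu A).

(* The total variation measure |mu|, evaluated at a measurable set B. *)
Definition variation (R : realType) (mu : cmeasure R) (B : set R) : \bar R :=
  ereal_sup [set r | exists n (A : 'I_n -> set R),
    [/\ forall i, measurable (A i),
        trivIset setT A,
        \bigcup_i A i = B &
        r = (\sum_(i < n) normc (cval mu (A i)))%:E] ].

Definition tv_norm (R : realType) (mu : cmeasure R) : \bar R :=
  variation mu setT.

Definition vanishes_outside (R : realType) (mu : cmeasure R) (D : set R) :=
  variation mu (~` D) = 0%E.

Definition finitely_atomic (R : realType) (mu : cmeasure R) :=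
  exists2 F : set R, finite_set F & vanishes_outside mu F.

Definition msupport (R : realType) (mu : cmeasure R) : set R :=
  [set x | forall U : set R, open U -> U x -> (0 < variation mu U)%E].

(* Integral against a charge through its Jordan decomposition; the value does
   not depend on the Hahn decomposition picked by [cid]. *)
Definition charge_integral (R : realType)
    (nu : {charge set R -> \bar R}) (D : set R) (f : R -> R)
    : R :=
  let HP := cid (Hahn_decomposition nu) in
  let HN := cid (projT2 HP) in
  Rintegral (jordan_pos (projT2 HN)) D f
  - Rintegral (jordan_neg (projT2 HN)) D f.

Definition cintegral (R : realType) (mu : cmeasure R) (D : set R) (f : R -> R)
    : R[i] :=
  charge_integral (cm_re mu) D f +i* charge_integral (cm_im mu) D f.

Definition sum_dirac (R : realType) (s : nat) (c t : 'I_s -> R)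
    : {charge set R -> \bar R} :=
  foldr (fun i (nu : {charge set R -> \bar R}) =>
           cadd (cscale (c i) (charge_of_finite_measure (dirac (t i)))) nu)
        czero (enum 'I_s).

(* \sum_k amp_k e^(i theta_k) \d_(tau_k) *)
Definition spike_train (R : realType) (s : nat) (amp theta tau : 'I_s -> R)
    : cmeasure R :=
  CMeasure (sum_dirac (fun k => amp k * cos (theta k)) tau)
           (sum_dirac (fun k => amp k * sin (theta k)) tau).

Definition unit_segment (R : realType) : set R := [set x | -1 <= x <= 1].

Definition cheb (R : realType) (k : nat) (x : R) : R :=
  if k is 0 then 1 else Num.sqrt 2 * cos (k%:R * acos x).

Definition cheb_span (R : realType) (m : nat) : set (R -> R[i]) :=
  [set P | exists a : 'I_m.+1 -> R[i],
     P = fun x => \sum_(k < m.+1) a k * (cheb k x)%:C].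

Definition cheb_moments (R : realType) (m : nat) (mu : cmeasure R)
    : 'I_m.+1 -> R[i] :=
  fun k => cintegral mu (@unit_segment R) (cheb k).

(* The default value Cb of the iterated minimum over the points is neutral
   here, since every term is at most Cb. *)
Definition QIC (R : realType) (m s : nat) (tau : 'I_s -> R) (Ca Cb : R) :=
  [/\ 0 < Ca, 0 < Cb, Cb < 1 &
      forall theta : 'I_s -> R, exists P : R -> R[i],
        [/\ cheb_span m P,
            forall k, P (tau k) = expi (- theta k) &
            forall x, unit_segment x ->
              \big[Num.min/Cb]_(k < s)
                 Num.min (Ca * m%:R ^+ 2 * `|x - tau k| ^+ 2) Cb
              <= 1 - normc (P x)] ].

Definition blasso_objective (R : realType) (m : nat) (y : 'I_m.+1 -> R[i])
    (lambda : R) (mu : cmeasure R) : \bar R :=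
  ((2^-1 * \sum_(k < m.+1) normc (cheb_moments mu k - y k) ^+ 2)%:E
   + lambda%:E * tv_norm mu)%E.

Definition blasso_solution (R : realType) (m : nat) (y : 'I_m.+1 -> R[i])
    (lambda : R) (nu : cmeasure R) :=
  vanishes_outside nu (@unit_segment R) /\
  forall mu, vanishes_outside mu (@unit_segment R) ->
    (blasso_objective y lambda nu <= blasso_objective y lambda mu)%E.

(* For a finite family, independence of all the variables already covers every
   subfamily: take B k = setT for the omitted indices. *)
Definition independent_RVs (R : realType) (d : measure_display)
    (Omega : measurableType d) (Pr : probability Omega R) (n : nat)
    (X : 'I_n -> {RV Pr >-> R}) :=
  forall B : 'I_n -> set R, (forall k, measurable (B k)) ->
    Pr (\bigcap_k (X k @^-1` B k)) = (\prod_(k < n) Pr (X k @^-1` B k))%E.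

Definition iid_gaussian (R : realType) (d : measure_display)
    (Omega : measurableType d) (Pr : probability Omega R) (n : nat)
    (sigma : R) (X : 'I_n -> {RV Pr >-> R}) :=
  independent_RVs X /\
  forall k (B : set R), measurable B ->
    distribution Pr (X k) B = normal_prob 0 sigma B.

Definition lambda_M (R : realType) (m : nat) (sigma : R) : R :=
  sigma * Num.sqrt (6 * m%:R * ln m%:R).

Definition Cprime (R : realType) (Ca Cb : R) : R :=
  2 + Num.max (2 * (1 - Cb) / Cb) (4 / (Ca - Cb)).

(* Main.v *)
(** With the required probability the noise vector has Euclidean norm at most
    [lambda]. On that event, first-order optimality bounds the residual
    polynomial by [lambda] on [-1, 1], hence its coefficients by [lambda] in
    Euclidean norm (the Chebyshev system is orthonormal for a discrete uniform
    measure), and comparing the objective at the solution and at the target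
    gives, for the dual polynomial [P] of the target,
    [\sum_x |c_x| (1 - |P x|) <= 2 lambda] over the atoms [c_x] of the solution.
    This already localizes the heavy atoms, which is (i). For (ii) one tests
    against [Q = (P1 + P2) / 2], where [P1] and [P2] are real, agree at [T_j]
    and are opposite at the other points of the support. Near such a point
    [Q] is quadratically small by Bernstein's inequality in the angular
    variable; the change of variable costs [1 / c0], which the condition
    [Cb / Ca <= c0 ^ 2] absorbs, because the isolation condition and Bernstein's
    inequality also force [Cb <= c0]. *)
Require Import Defs.
From mathcomp Require Import all_boot all_order all_algebra.
From mathcomp Require Import complex.
From mathcomp Require Import all_classical all_reals all_analysis.
From mathcomp Require Import measurable_realfun.
From mathcomp Require Import ring lra zify.
Set Implicit Arguments.
Unset Strict Implicit.
Unset Printing Implicit Defensive.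
Import Order.TTheory GRing.Theory Num.Theory.
Import numFieldNormedType.Exports.
Import Normc.
Import Defs.
Local Open Scope classical_set_scope.
Local Open Scope ring_scope.
Local Open Scope complex_scope.

(** * Chebyshev sums on a regular grid *)

Lemma cos_mulDn (R : realType) (k : nat) (t : R) :
  cos (k.+2%:R * t) = 2 * cos t * cos (k.+1%:R * t) - cos (k%:R * t).
Proof.
have -> : k.+2%:R * t = k.+1%:R * t + t by rewrite -[k.+2%:R]natr1; ring.
have -> : k%:R * t = k.+1%:R * t - t by rewrite -[k.+1%:R]natr1; ring.
by rewrite cosD cosB; ring.
Qed.

(** By the recurrence, [cos (k t)] depends on [t] through [cos t] alone. This replaces
    [acos (cos t)] by [t] even outside [[0, pi]]. *)
Lemma eq_cos_natmul (R : realType) (k : nat) (s t : R) :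
  cos s = cos t -> cos (k%:R * s) = cos (k%:R * t).
Proof.
move=> st; suff: cos (k%:R * s) = cos (k%:R * t) /\
  cos (k.+1%:R * s) = cos (k.+1%:R * t) by case.
elim: k => [|k [IHk IHk1]]; first by rewrite !mul0r !mul1r.
by split=> //; rewrite !cos_mulDn st IHk IHk1.
Qed.

Lemma mul2_cosM (R : realType) (s t : R) :
  2 * (cos s * cos t) = cos (s + t) + cos (s - t).
Proof. by rewrite cosD cosB; ring. Qed.

Lemma sinD_natpi (R : realType) (n : nat) (t : R) :
  sin (t + n%:R * (2 * pi)) = sin t.
Proof.
elim: n => [|n IHn]; first by rewrite mul0r addr0.
have -> : t + n.+1%:R * (2 * pi) = (t + n%:R * (2 * pi)) + pi *+ 2.
  by rewrite -natr1 -mulr_natl; ring.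
by rewrite sinD2pi.
Qed.

Lemma cosD_natpi (R : realType) (n : nat) (t : R) :
  cos (t + n%:R * (2 * pi)) = cos t.
Proof. by rewrite -sinDpihalf addrAC sinD_natpi sinDpihalf. Qed.

Lemma cos_npi (R : realType) (n : nat) : cos (n%:R * pi) = (-1) ^+ n :> R.
Proof.
elim: n => [|n IHn]; first by rewrite mul0r cos0.
by rewrite -natr1 mulrDl mul1r cosDpi IHn exprS mulN1r.
Qed.

(** Dirichlet kernel: the factor [2 * sin (t / 2)] turns each term into a difference of sines, and
    the sum telescopes. *)
Lemma sum_cos_natmul (R : realType) (N : nat) (t : R) :
  2 * sin (t / 2) * \sum_(i < N) cos (i%:R * t) =
  sin (N%:R * t - t / 2) + sin (t / 2).
Proof.
elim: N => [|N IHN]; first by rewrite big_ord0 mulr0 mul0r sub0r sinN addNr.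
rewrite big_ord_recr /= mulrDr IHN.
have -> : N.+1%:R * t - t / 2 = N%:R * t + t / 2 by rewrite -natr1; field.
by rewrite sinB sinD; ring.
Qed.

(** Over a full period the right-hand side of the kernel identity is zero, while [0 < j < N] keeps
    [sin (t / 2)] positive. *)
Lemma sum_cos_period (R : realType) (N j : nat) : (0 < j < N)%N ->
  \sum_(i < N) cos (i%:R * (j%:R * (2 * pi) / N%:R)) = 0 :> R.
Proof.
move=> /andP[j0 jN]; set t : R := _ / _.
have N0 : (0 : R) < N%:R by rewrite ltr0n; lia.
have t2 : t / 2 = pi * (j%:R / N%:R) by rewrite /t; field; rewrite lt0r_neq0.
have s0 : 0 < sin (t / 2).
  apply: sin_gt0_pi; rewrite t2 mulr_gt0 ?pi_gt0 ?divr_gt0 ?ltr0n//=.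
    by rewrite gtr_pMr ?pi_gt0// ltr_pdivrMr// mul1r ltr_nat.
  by lia.
have := sum_cos_natmul N t.
have -> : N%:R * t - t / 2 = - (t / 2) + j%:R * (2 * pi).
  by rewrite /t; field; rewrite lt0r_neq0.
rewrite sinD_natpi sinN addNr => /eqP; rewrite mulf_eq0 => /orP[|/eqP//].
by rewrite mulf_eq0 pnatr_eq0 /= gt_eqF.
Qed.

Definition cheb_norm (R : realType) (k : nat) : R :=
  if k is 0 then 1 else Num.sqrt 2.

Lemma cheb_cos (R : realType) (k : nat) (t : R) :
  cheb k (cos t) = cheb_norm R k * cos (k%:R * t).
Proof.
case: k => [|k] /=; first by rewrite mul0r cos0 mulr1.
congr (_ * _); apply: eq_cos_natmul; apply: acosK.
by rewrite in_itv /= cos_geN1 cos_le1.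
Qed.

Lemma unit_segment_cos (R : realType) (t : R) : unit_segment (cos t).
Proof. by rewrite /unit_segment /= cos_geN1 cos_le1. Qed.

(** A product of cosines splits into the frequencies [k + l] and [k - l]. Both are below [2 m + 1],
    so each sums to zero over the grid unless it is itself zero. *)
Lemma cheb_discrete_orthonormal (R : realType) (m : nat) (k l : 'I_m.+1) :
  \sum_(i < m.*2.+1)
     cheb k (cos (i%:R * (2 * pi) / m.*2.+1%:R)) *
     cheb l (cos (i%:R * (2 * pi) / m.*2.+1%:R)) =
  m.*2.+1%:R * (k == l)%:R :> R.
Proof.
wlog lk : k l / (l <= k)%N.
  move=> h; case/orP: (leq_total l k) => [/h//|/h].
  by rewrite eq_sym => <-; apply: eq_bigr => i _; rewrite mulrC.
set N : R := m.*2.+1%:R; have N0 : N != 0 by rewrite pnatr_eq0.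
have sumE (j : nat) : (j < m.*2.+1)%N ->
    \sum_(i < m.*2.+1) cos (j%:R * (i%:R * (2 * pi) / N)) = N * (j == 0%N)%:R.
  move=> jN; have [->|j0] := eqVneq j 0%N.
    under eq_bigr do rewrite mul0r cos0.
    by rewrite sumr_const card_ord mulr1.
  rewrite mulr0 -[RHS](@sum_cos_period R m.*2.+1 j) ?lt0n ?j0//.
  by apply: eq_bigr => i _; congr cos; rewrite /N; field.
rewrite (eq_bigr (fun i : 'I_m.*2.+1 => cheb_norm R k * cheb_norm R l / 2 *
   (cos ((k + l)%N%:R * (i%:R * (2 * pi) / N)) +
    cos ((k - l)%N%:R * (i%:R * (2 * pi) / N))))); last first.
  move=> i _; rewrite !cheb_cos; set t := _ / N.
  have := mul2_cosM (k%:R * t) (l%:R * t).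
  by rewrite -mulrDl -mulrBl -natrD -natrB// => <-; field.
rewrite -mulr_sumr big_split /= !sumE; last 2 first.
- by have := ltn_ord k; have := ltn_ord l; lia.
- by have := ltn_ord k; lia.
rewrite -val_eqE /= subn_eq0 addn_eq0.
have -> : (k <= l)%N = (k == l :> nat) by rewrite eqn_leq lk andbT.
have [kl|kl] := eqVneq (k : nat) l; last first.
  have -> : (k == 0 :> nat) && (l == 0 :> nat) = false by apply/negP; lia.
  by rewrite !mulr0 addr0 mulr0.
rewrite kl andbb; case: (l : nat) => [|n] /=; first by field.
by rewrite -expr2 sqr_sqrtr//; field.
Qed.

(* The two families are the real and imaginary parts of the coefficients. *)
Lemma cheb_parseval_le (R : realType) (m : nat) (a b : 'I_m.+1 -> R) (B : R) :
  (forall x, unit_segment x ->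
     (\sum_k a k * cheb k x) ^+ 2 + (\sum_k b k * cheb k x) ^+ 2 <= B) ->
  \sum_k (a k ^+ 2 + b k ^+ 2) <= B.
Proof.
move=> le_B; set N : R := m.*2.+1%:R; have N0 : 0 < N by rewrite ltr0n.
pose x (i : 'I_m.*2.+1) : R := cos (i%:R * (2 * pi) / N).
(* Expanding the square and summing over the grid leaves only the diagonal terms. *)
have parseval (c : 'I_m.+1 -> R) :
    \sum_i (\sum_k c k * cheb k (x i)) ^+ 2 = N * \sum_k c k ^+ 2.
  under eq_bigr do rewrite expr2 mulr_suml.
  rewrite exchange_big mulr_sumr; apply: eq_bigr => k _ /=.
  under eq_bigr do rewrite mulr_sumr.
  rewrite exchange_big (bigD1 k)//= [X in _ + X]big1 ?addr0 => [|l lk].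
    under eq_bigr do rewrite mulrACA.
    by rewrite -mulr_sumr cheb_discrete_orthonormal eqxx mulr1 mulrC expr2.
  under eq_bigr do rewrite mulrACA.
  by rewrite -mulr_sumr cheb_discrete_orthonormal eq_sym (negPf lk) !mulr0.
rewrite -(ler_pM2l N0) big_split mulrDr -!parseval -big_split /=.
have -> : N * B = \sum_(i < m.*2.+1) B by rewrite sumr_const card_ord mulr_natl.
by apply: ler_sum => i _; apply: le_B; apply: unit_segment_cos.
Qed.

(** * Bernstein's inequality *)

(* The weights of the Riesz interpolation formula on the grid [l pi / m],
   [0 < l < 2 m]; the point [l = 0] carries minus their sum. *)
Definition riesz_weight (R : realType) (m l : nat) : R :=
  (-1) ^+ l / (2 * sin (l%:R * pi / m.*2%:R) ^+ 2).

Lemma sin_riesz_gt0 (R : realType) (m l : nat) : (0 < l < m.*2)%N ->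
  0 < sin (l%:R * pi / m.*2%:R) :> R.
Proof.
move=> /andP[l0 lm]; have m0 : (0 : R) < m.*2%:R by rewrite ltr0n; lia.
have l0R : (0 : R) < l%:R by rewrite ltr0n.
apply: sin_gt0_pi; rewrite divr_gt0 ?mulr_gt0 ?pi_gt0//=.
by rewrite ltr_pdivrMr// mulrC ltr_pM2l ?pi_gt0// ltr_nat.
Qed.

Lemma normr_riesz_weight (R : realType) (m l : nat) : (0 < l < m.*2)%N ->
  `|riesz_weight R m l| = (-1) ^+ l * riesz_weight R m l.
Proof.
move=> lm; have s0 := @sin_riesz_gt0 R m l lm.
rewrite /riesz_weight normrM normrX normrN1 expr1n [RHS]mulrA -exprMn mulrNN.
by rewrite mulr1 expr1n ger0_norm// invr_ge0 mulr_ge0// sqr_ge0.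
Qed.

(** [1 - cos (2 u) = 2 sin^2 u] cancels the denominator of the weight. Second differences in the
    frequency produce this factor. *)
Lemma riesz_weightM (R : realType) (m l : nat) : (0 < l < m.*2)%N ->
  riesz_weight R m l * (2 * (1 - cos (l%:R * pi / m%:R))) = 2 * (-1) ^+ l.
Proof.
move=> lm; have s0 := @sin_riesz_gt0 R m l lm.
have m0 : (0 : R) < m%:R by rewrite ltr0n; lia.
have -> : l%:R * pi / m%:R = (l%:R * pi / m.*2%:R) *+ 2 :> R.
  by rewrite -muln2 natrM -mulr_natr; field; rewrite lt0r_neq0.
rewrite cos_mulr2n cos2sin2 /riesz_weight; field.
by rewrite lt0r_neq0.
Qed.

Lemma cosD_npi (R : realType) (n : nat) (t : R) :
  cos (t + n%:R * pi) = (-1) ^+ n * cos t.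
Proof.
elim: n => [|n IHn]; first by rewrite mul0r addr0 mul1r.
by rewrite -natr1 mulrDl mul1r addrA cosDpi IHn exprS -mulrA mulN1r.
Qed.

(** The sign [(-1)^l] shifts the frequency from [k] to [k + m < 2 m]; the full-period sum vanishes,
    and the omitted term [l = 0] is 1. *)
Lemma sum_alternating_cos (R : realType) (m k : nat) : (k < m)%N ->
  \sum_(1 <= l < m.*2) (-1) ^+ l * cos (k%:R * (l%:R * pi / m%:R)) = -1 :> R.
Proof.
move=> km; have m0 : (0 : R) < m%:R by rewrite ltr0n; lia.
have := @sum_cos_period R m.*2 (k + m) ltac:(lia).
rewrite -(big_mkord xpredT (fun i => cos (i%:R * ((k + m)%N%:R * (2 * pi) / m.*2%:R)))).
rewrite big_ltn; last by lia.
rewrite mul0r cos0 => /eqP; rewrite addrC addr_eq0 => /eqP sumE.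
rewrite -[RHS]sumE; apply: eq_big_nat => l _; rewrite -cosD_npi; congr cos.
by rewrite -muln2 natrM natrD; field; rewrite lt0r_neq0.
Qed.

(** Both sides agree at [k = 0] and [k = 1], and both have second difference 2 in [k], by the
    alternating sum. *)
Lemma riesz_sqr (R : realType) (m k : nat) : (k <= m)%N ->
  \sum_(1 <= l < m.*2) riesz_weight R m l * (cos (k%:R * (l%:R * pi / m%:R)) - 1)
  = k%:R ^+ 2.
Proof.
pose f k := \sum_(1 <= l < m.*2)
  riesz_weight R m l * (cos (k%:R * (l%:R * pi / m%:R)) - 1).
have f0 : f 0%N = 0.
  by rewrite /f big1// => l _; rewrite mul0r cos0 subrr mulr0.
have f1 : (0 < m)%N -> f 1%N = 1.
  move=> m0; rewrite -[RHS]opprK -(@sum_alternating_cos R m 0)// -sumrN.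
  apply: eq_big_nat => l lm; rewrite mul0r cos0 mul1r mulr1.
  by have /= := @riesz_weightM R m l lm; lra.
have fS n : (n.+1 < m)%N -> f n.+2 - 2 * f n.+1 + f n = 2.
  move=> nm; transitivity (- (2 *
      \sum_(1 <= l < m.*2) (-1) ^+ l * cos (n.+1%:R * (l%:R * pi / m%:R))) : R).
    2: by rewrite sum_alternating_cos//; ring.
  rewrite /f 2!mulr_sumr -!sumrN -!big_split /=.
  apply: eq_big_nat => l lm; rewrite cos_mulDn.
  have /= := @riesz_weightM R m l lm; move: (cos (l%:R * _ / _)) => c.
  move: (cos (_ * _)) (cos (_ * _)) (riesz_weight _ _ _) => a b w.
  by move=> /(congr1 (fun z => z * b)) /=; lra.
suff H n : (n.+1 <= m)%N -> f n = n%:R ^+ 2 /\ f n.+1 = n.+1%:R ^+ 2.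
  by case: k => [_|k /H[]//]; rewrite expr2 mul0r; exact: f0.
elim: n => [|n IHn] nm; first by rewrite f0 f1// expr2 mul0r expr1n.
have [fn fn1] := IHn (ltnW nm); split=> //.
have := fS _ nm; rewrite fn fn1 -[n.+2%:R]natr1 -[n.+1%:R]natr1.
by move: (n%:R) => r; lra.
Qed.

(** Up to the factor [2 m], this is the sum over [k < 2 m] of the left-hand sides [f k] of
    [riesz_sqr], since full-period cosine sums vanish. Each [f k] is a square: [k^2] up to [m], and
    [(2 m - k)^2] beyond by symmetry. *)
Lemma riesz_weight0_ge0 (R : realType) (m : nat) :
  0 <= - \sum_(1 <= l < m.*2) riesz_weight R m l.
Proof.
have [->|m0] := posnP m; first by rewrite big_geq// oppr0.
have mR : (0 : R) < m.*2%:R by rewrite ltr0n; lia.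
pose f k := \sum_(1 <= l < m.*2)
  riesz_weight R m l * (cos (k%:R * (l%:R * pi / m%:R)) - 1).
have f_ge0 (k : 'I_m.*2) : 0 <= f k.
  have [km|km] := leqP k m; first by rewrite /f riesz_sqr// sqr_ge0.
  have -> : f k = f (m.*2 - k)%N.
    apply: eq_big_nat => l lm; congr (_ * (_ - 1)).
    rewrite -[RHS]cosN -[RHS](cosD_natpi l); congr cos.
    rewrite natrB; last exact/ltnW.
    have -> : m.*2%:R = 2 * m%:R :> R by rewrite -mul2n natrM.
    by field; rewrite pnatr_eq0 -lt0n.
  by rewrite /f riesz_sqr ?sqr_ge0//; lia.
rewrite -(pmulr_rge0 _ mR).
have -> : m.*2%:R * - (\sum_(1 <= l < m.*2) riesz_weight R m l) =
          \sum_(k < m.*2) f k.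
  rewrite exchange_big /= mulrN mulr_sumr -sumrN; apply: eq_big_nat => l lm.
  rewrite -mulr_sumr sumrB sumr_const card_ord.
  have -> : \sum_(i < m.*2) cos (i%:R * (l%:R * pi / m%:R)) = 0 :> R.
    rewrite -[RHS](@sum_cos_period R m.*2 l)//; apply: eq_bigr => i _.
    have -> : m.*2%:R = 2 * m%:R :> R by rewrite -mul2n natrM.
    by congr cos; field; rewrite pnatr_eq0 -lt0n.
  by ring.
by apply: sumr_ge0 => k _; apply: f_ge0.
Qed.

(** Riesz interpolation writes the sum with coefficients [k^2 * b k] as a combination of translates
    of the original one. The total absolute weight is [m^2]: at [k = m] the cosines in [riesz_sqr]
    are exactly the signs of the weights. *)
Lemma bernstein_cos_sum (R : realType) (m : nat) (b : nat -> R) (B : R) :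
  (forall t, `|\sum_(k < m.+1) b k * cos (k%:R * t)| <= B) ->
  forall t, `|\sum_(k < m.+1) k%:R ^+ 2 * b k * cos (k%:R * t)| <= m%:R ^+ 2 * B.
Proof.
set G := fun t => \sum_(k < m.+1) b k * cos (k%:R * t) => G_le t.
set W0 := - \sum_(1 <= l < m.*2) riesz_weight R m l.
have sumE : \sum_(k < m.+1) k%:R ^+ 2 * b k * cos (k%:R * t) =
    W0 * G t + \sum_(1 <= l < m.*2) riesz_weight R m l *
      ((G (t + l%:R * pi / m%:R) + G (t - l%:R * pi / m%:R)) / 2).
  transitivity (\sum_(k < m.+1) \sum_(1 <= l < m.*2)
      (riesz_weight R m l * (cos (k%:R * (l%:R * pi / m%:R)) - 1)) *
      (b k * cos (k%:R * t))).
    apply: eq_bigr => k _; rewrite -mulr_suml riesz_sqr -?mulrA//.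
    by rewrite -ltnS.
  rewrite exchange_big /= /W0 mulNr mulr_suml -sumrN -big_split /=.
  apply: eq_bigr => l _.
  rewrite /G -big_split /= mulr_suml !mulr_sumr -sumrN -big_split /=.
  apply: eq_bigr => k _; set u := l%:R * pi / m%:R.
  have := mul2_cosM (k%:R * t) (k%:R * u); rewrite -mulrDr -mulrBr.
  move/(canLR (addKr _)) => <-.
  by field.
have massE : W0 + \sum_(1 <= l < m.*2) `|riesz_weight R m l| = m%:R ^+ 2.
  rewrite -(@riesz_sqr R m m (leqnn _)) /W0 -sumrN -big_split /=.
  apply: eq_big_nat => l lm; rewrite normr_riesz_weight//.
  have -> : m%:R * (l%:R * pi / m%:R) = l%:R * pi :> R.
    by field; rewrite pnatr_eq0; lia.
  by rewrite cos_npi; ring.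
rewrite sumE -massE mulrDl; apply: le_trans (ler_normD _ _) (lerD _ _).
  have W0_ge0 : 0 <= W0 := riesz_weight0_ge0 R m.
  by rewrite normrM (ger0_norm W0_ge0) ler_wpM2l //; exact: G_le.
apply: le_trans (ler_norm_sum _ _ _) _; rewrite mulr_suml; apply: ler_sum => l _.
rewrite normrM ler_wpM2l// normrM (@ger0_norm _ 2^-1) ?invr_ge0//.
rewrite ler_pdivrMr// mulr_natr mulr2n.
exact: le_trans (ler_normD _ _) (lerD (G_le _) (G_le _)).
Qed.

(** * Quadratic behaviour near a maximum *)

Lemma ge0_of_derive_ge0 (R : realType) (f df : R -> R) :
  (forall u : R, is_derive u 1 f (df u)) -> f 0 = 0 ->
  (forall u, 0 <= u -> 0 <= df u) -> forall u, 0 <= u -> 0 <= f u.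
Proof.
move=> dfP f0 df_ge0 u u0.
have fc : {within `[0, u], continuous f}.
  apply: continuous_subspaceT => x.
  exact/differentiable_continuous/derivable1_diffP/(ex_derive (is_derive := dfP x)).
have [c] := MVT_segment u0 (fun x _ => dfP x) fc.
rewrite in_itv /= => /andP[c0 _]; rewrite f0 !subr0 => ->.
by rewrite mulr_ge0// df_ge0.
Qed.

Lemma is_derive_mulr (R : realType) (c u : R) : is_derive u 1 ( *%R c) c.
Proof.
have -> : *%R c = c *: (id : R -> R) by [].
by apply: is_derive_eq; rewrite /GRing.scale /= mulr1.
Qed.

Lemma is_derive_cosM (R : realType) (c u : R) :
  is_derive u 1 (fun t => cos (c * t)) (- (c * sin (c * u))).
Proof.
have -> : - (c * sin (c * u)) = - sin (c * u) * c by ring.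
exact: (@is_derive1_comp R cos ( *%R c) u _ _ (is_derive_cos _) (is_derive_mulr _ _)).
Qed.

Lemma is_derive_sinM (R : realType) (c u : R) :
  is_derive u 1 (fun t => sin (c * t)) (c * cos (c * u)).
Proof.
rewrite mulrC.
exact: (@is_derive1_comp R sin ( *%R c) u _ _ (is_derive_sin _) (is_derive_mulr _ _)).
Qed.

Lemma is_derive_sumZ (R : realType) (n : nat) (a : 'I_n -> R)
    (h : 'I_n -> R -> R) (dh : 'I_n -> R) (u : R) :
  (forall k, is_derive u 1 (h k) (dh k)) ->
  is_derive u 1 (fun t => \sum_k a k * h k t) (\sum_k a k * dh k).
Proof.
move=> dhP; have -> : (fun t => \sum_k a k * h k t) = \sum_k (a k *: h k).
  by apply/funext => v; rewrite fct_sumE.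
by apply: is_derive_sum => k; apply: is_deriveZ.
Qed.

(* A cosine sum that attains its maximal modulus at [0] dominates its
   second-order Taylor polynomial, by Bernstein's bound on its second
   derivative. *)
Lemma cos_sum_at_max (R : realType) (m : nat) (b : nat -> R) (t : R) :
  (forall t, `|\sum_(k < m.+1) b k * cos (k%:R * t)| <= \sum_(k < m.+1) b k) ->
  0 <= t ->
  \sum_(k < m.+1) b k - \sum_(k < m.+1) b k * cos (k%:R * t) <=
  m%:R ^+ 2 * (\sum_(k < m.+1) b k) * t ^+ 2 / 2.
Proof.
set B := \sum_(k < m.+1) b k => le_B t0.
pose G t := \sum_(k < m.+1) b k * cos (k%:R * t).
pose D t := \sum_(k < m.+1) b k * (- (k%:R * sin (k%:R * t))).
have dG (u : R) : is_derive u 1 G (D u).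
  by apply: is_derive_sumZ => k; apply: is_derive_cosM.
have dD (u : R) : is_derive u 1 D
    (\sum_(k < m.+1) b k * (- (k%:R * (k%:R * cos (k%:R * u))))).
  apply: is_derive_sumZ => k.
  have -> : (fun t => - (k%:R * sin (k%:R * t))) =
            - (k%:R : R) *: (fun t => sin (k%:R * t)).
    by apply/funext => v; rewrite -mulNr.
  by rewrite -mulNr; apply: is_deriveZ; apply: is_derive_sinM.
pose c := m%:R ^+ 2 * B.
(* First of two integrations from 0: the derivative of [c * u + D u] is nonnegative by Bernstein's
   inequality. *)
have D_ge : forall u, 0 <= u -> 0 <= c * u + D u.
  apply: (ge0_of_derive_ge0 (fun u => is_deriveD (is_derive_mulr c u) (dD u))).
  - rewrite addrfctE mulr0 add0r /D big1// => k _.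
    by rewrite mulr0 sin0 mulr0 oppr0 mulr0.
  - move=> u _; have := bernstein_cos_sum le_B u.
    rewrite ler_norml => /andP[_]; rewrite -/c -subr_ge0.
    congr (0 <= _); rewrite -sumrN; congr (_ + _).
    by apply: eq_bigr => k _; ring.
have dsqr (u : R) : is_derive u 1 (fun x => c / 2 * x ^+ 2) (c * u).
  have -> : c * u = (c / 2) *: ((2%:R * u ^+ 1) *: (1 : R)).
    by rewrite /GRing.scale /= mulr1 expr1; field.
  have -> : (fun x : R => c / 2 * x ^+ 2) = (c / 2) *: ((id : R -> R) ^+ 2) by [].
  by apply: is_deriveZ; apply: is_deriveX.
have dGB (u : R) : is_derive u 1 (fun x => G x - B) (D u).
  by rewrite -[D u]subr0; apply: is_deriveB.
have : 0 <= c / 2 * t ^+ 2 + (G t - B).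
  move: t t0; apply: (ge0_of_derive_ge0 (fun u => is_deriveD (dsqr u) (dGB u))).
  - rewrite addrfctE expr0n mulr0 add0r /G; apply/eqP; rewrite subr_eq0; apply/eqP.
    by apply: eq_bigr => k _; rewrite mulr0 cos0 mulr1.
  - exact: D_ge.
rewrite -/(G t) -/c; lra.
Qed.

(** Symmetrizing about [s] gives a pure cosine sum in [u], maximal at [u = 0] with value 2. One of
    the two symmetric points is [t]; the value at the other is at most 1. *)
Lemma cos_sum_near_max (R : realType) (m : nat) (a : nat -> R) (s t : R) :
  (forall u, `|\sum_(k < m.+1) a k * cos (k%:R * u)| <= 1) ->
  \sum_(k < m.+1) a k * cos (k%:R * s) = 1 ->
  1 - \sum_(k < m.+1) a k * cos (k%:R * t) <= m%:R ^+ 2 * (t - s) ^+ 2.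
Proof.
set P := fun u => \sum_(k < m.+1) a k * cos (k%:R * u) => le1 Ps1.
pose b k := 2 * a k * cos (k%:R * s).
have GE u : \sum_(k < m.+1) b k * cos (k%:R * u) = P (s + u) + P (s - u).
  rewrite /P -big_split /=; apply: eq_bigr => k _.
  have := mul2_cosM (k%:R * s) (k%:R * u).
  by rewrite -mulrDr -mulrBr /b -mulrDr => <-; ring.
have b2 : \sum_(k < m.+1) b k = 2.
  have := GE 0; rewrite subr0 addr0 /P Ps1.
  have -> : \sum_(k < m.+1) b k * cos (k%:R * 0) = \sum_(k < m.+1) b k.
    by apply: eq_bigr => k _; rewrite mulr0 cos0 mulr1.
  by move=> ->.
have P_le u : `|P u| <= 1 by exact: le1.
have : 2 - (P (s + `|t - s|) + P (s - `|t - s|)) <= m%:R ^+ 2 * (t - s) ^+ 2.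
  rewrite -GE -b2 -[(t - s) ^+ 2]real_normK ?num_real//.
  apply: le_trans (@cos_sum_at_max R m b `|t - s| _ _) _ => //; last first.
    by rewrite b2 le_eqVlt; apply/orP; left; apply/eqP; field.
  move=> u; rewrite GE b2; apply: le_trans (ler_normD _ _) _.
  by have := P_le (s + u); have := P_le (s - u); lra.
rewrite -/(P t).
have [E|E] : s + `|t - s| = t \/ s - `|t - s| = t.
- have [ts|/ltW ts] := leP 0 (t - s).
    by left; rewrite ger0_norm//; ring.
  by right; rewrite ler0_norm//; ring.
- by have := P_le (s - `|t - s|); rewrite E ler_norml; lra.
- by have := P_le (s + `|t - s|); rewrite E ler_norml; lra.
Qed.

(** Mean value theorem: [acos] has slope [- 1 / sqrt (1 - z^2)], and the concave function [1 - z^2]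
    stays above [c] between [x] and [y]. *)
Lemma acos_lipschitz (R : realType) (c x y : R) :
  0 < c -> c <= 1 - x ^+ 2 -> c <= 1 - y ^+ 2 ->
  c * (acos x - acos y) ^+ 2 <= (x - y) ^+ 2.
Proof.
wlog xy : x y / x <= y.
  move=> H c0 cx cy; have [/H|/ltW/H] := leP x y; first exact.
  by rewrite -(opprB (acos x)) sqrrN -(opprB x) sqrrN; apply.
move=> c0 cx cy.
have between z : z \in `[x, y] -> c <= 1 - z ^+ 2 /\ -1 < z < 1.
  rewrite in_itv /= => /andP[xz zy].
  have cz : c <= 1 - z ^+ 2 by have [z0|/ltW z0] := leP 0 z; nra.
  by split=> //; apply/andP; split; nra.
have dacos z : z \in `]x, y[ -> is_derive z 1 acos (- (Num.sqrt (1 - z ^+ 2))^-1).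
  move=> zxy; apply: is_derive1_acos; apply: (between _ _).2.
  by move: zxy; rewrite !in_itv /= => /andP[/ltW-> /ltW->].
have cacos : {within `[x, y], continuous (@acos R)}.
  apply: continuous_in_subspaceT => z; rewrite inE /= => zxy.
  exact/continuous_acos/(between _ zxy).2.
have [z zxy] := MVT_segment xy dacos cacos.
have [cz _] := between _ zxy.
rewrite -(opprB (acos y)) sqrrN -(opprB y) sqrrN => ->.
rewrite mulNr sqrrN exprMn exprVn sqr_sqrtr ?(le_trans (ltW c0))//.
rewrite mulrA ler_piMl ?sqr_ge0// ler_pdivrMr ?mul1r//.
exact: lt_le_trans c0 cz.
Qed.

Lemma cheb_acos (R : realType) (k : nat) (x : R) :
  cheb k x = cheb_norm R k * cos (k%:R * acos x).
Proof. by case: k => [|k] //=; rewrite mul0r cos0 mulr1. Qed.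

Lemma cheb_sum_near_max (R : realType) (m : nat) (a : 'I_m.+1 -> R) (c x y : R) :
  (forall z, unit_segment z -> `|\sum_k a k * cheb k z| <= 1) ->
  \sum_k a k * cheb k x = 1 ->
  0 < c -> c <= 1 - x ^+ 2 -> c <= 1 - y ^+ 2 ->
  c * (1 - \sum_k a k * cheb k y) <= m%:R ^+ 2 * (y - x) ^+ 2.
Proof.
move=> le1 ax c0 cx cy.
(* The cosine lemmas take coefficients indexed by naturals; only indices up to [m] occur, so the
   default of [inord] is never met. *)
pose b (k : nat) := a (inord k) * cheb_norm R k.
have E z : \sum_k a k * cheb k z = \sum_(k < m.+1) b k * cos (k%:R * acos z).
  by apply: eq_bigr => k _; rewrite /b inord_val cheb_acos mulrA.
have b_le u : `|\sum_(k < m.+1) b k * cos (k%:R * u)| <= 1.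
  have := le1 (cos u) (unit_segment_cos u).
  rewrite (eq_bigr (fun k : 'I_m.+1 => b k * cos (k%:R * u)))// => k _.
  by rewrite /b inord_val cheb_cos mulrA.
have bx : \sum_(k < m.+1) b k * cos (k%:R * acos x) = 1 by rewrite -E.
have := cos_sum_near_max (acos y) b_le bx; rewrite -E => /(ler_wpM2l (ltW c0)).
move=> /le_trans; apply; rewrite mulrCA ler_wpM2l ?sqr_ge0//.
exact: acos_lipschitz.
Qed.

(** * Discrete measures *)

Lemma measurable_unit_segment (R : realType) : measurable (@unit_segment R).
Proof.
rewrite (_ : @unit_segment R = `[-1, 1]%classic); first exact: measurable_itv.
by apply/seteqP; split=> x; rewrite /unit_segment /= in_itv.
Qed.

(** On [[-1, 1]] the recurrence makes [cos (k acos x)] a polynomial in [x]. *)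
Lemma measurable_fun_cheb (R : realType) (k : nat) :
  measurable_fun (@unit_segment R) (cheb k).
Proof.
pose T (k : nat) (x : R) := cos (k%:R * acos x).
suff mT : measurable_fun (@unit_segment R) (T k).
  apply: (eq_measurable_fun (fun x => cheb_norm R k * T k x)).
    by move=> x _; rewrite cheb_acos.
  exact: measurable_funM.
suff : measurable_fun (@unit_segment R) (T k) /\
       measurable_fun (@unit_segment R) (T k.+1) by case.
elim: k => [|k [mk mk1]].
  split; first by apply: (eq_measurable_fun (cst 1 : R -> R)) => // x _; rewrite /T mul0r cos0.
  apply: (eq_measurable_fun (id : R -> R)) => // x; rewrite inE => xI.
  by rewrite /T mul1r acosK// in_itv.
split=> //; apply: (eq_measurable_fun (fun x : R => 2 * x * T k.+1 x - T k x : R)).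
  move=> x; rewrite inE => xI.
  by rewrite {3}/T cos_mulDn acosK ?in_itv.
by apply: measurable_funB => //; apply: measurable_funM => //; exact: measurable_funM.
Qed.

(** Atoms are peeled off one at a time; what remains is a null set. *)
Lemma integral_carried_by_seq (R : realType) (mu : {measure set R -> \bar R})
    (s : seq R) (D : set R) (f : R -> R) :
  uniq s -> measurable D -> {subset s <= D} -> measurable_fun D f ->
  mu (D `\` [set` s]) = 0%E ->
  (\int[mu]_(x in D) (f x)%:E = \sum_(x <- s) (f x)%:E * mu [set x])%E.
Proof.
elim: s D => [|x s IHs] D /= us mD sD mf mu0.
  rewrite big_nil null_set_integral//; first exact/measurable_EFinP.
  by rewrite -[D]setD0; rewrite (_ : set0 = [set` [::]])//; apply/seteqP; split.
move: us => /andP[xs us].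
have mx : measurable [set x] by exact: measurable_set1.
have Dx : D = [set x] `|` (D `\ x).
  rewrite setDUK// => _ ->.
  by have := sD x (mem_head _ _); rewrite inE.
rewrite [in LHS]Dx integral_setU//.
- rewrite big_cons; congr (_ + _)%E.
    rewrite (eq_integral (cst (f x)%:E)) ?integral_cst//.
    by move=> y; rewrite inE => ->.
  apply: IHs => //.
  + exact: measurableD.
  + move=> y ys; rewrite inE; split.
      by have := sD y; rewrite in_cons ys orbT inE; apply.
    by move=> /= yx; move: xs; rewrite -yx ys.
  + exact: measurable_funS mf.
  + rewrite -[RHS]mu0; congr (mu _); apply/seteqP; split=> y /=.
      by move=> [[Dy yx] ys]; split=> //; rewrite inE => /orP[/eqP|].
    by move=> [Dy]; rewrite inE => /negP; rewrite negb_or => /andP[/eqP yx /negP].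
- exact: measurableD.
- by rewrite -Dx; exact/measurable_EFinP.
- by apply/disj_setPRL => y [].
Qed.

Lemma measurable_seq (R : realType) (s : seq R) : measurable [set` s].
Proof.
apply: countable_measurable; last exact/finite_set_countable/finite_seq.
by move=> x; exact: measurable_set1.
Qed.

(** Every measurable subset of the complement is tested, since a charge can vanish on the complement
    itself by cancellation. *)
Definition charge_carried (R : realType) (nu : {charge set R -> \bar R}) (s : seq R) :=
  forall A, measurable A -> A `<=` ~` [set` s] -> nu A = 0%E.

(** Each Jordan part is, up to sign, the charge restricted to one side of the Hahn decomposition,
    hence vanishes off [s]; on singletons their difference is [nu] again. *)
Lemma charge_integral_carried (R : realType) (nu : {charge set R -> \bar R})
    (s : seq R) (D : set R) (f : R -> R) :
  uniq s -> measurable D -> {subset s <= D} -> measurable_fun D f ->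
  charge_carried nu s ->
  charge_integral nu D f = \sum_(x <- s) fine (nu [set x]) * f x.
Proof.
move=> us mD sD mf nus; rewrite /charge_integral /=.
case: cid => P HP; case: cid => N /= nuPN.
have mDs : measurable (D `\` [set` s]) by apply: measurableD => //; exact: measurable_seq.
have nu0 A : measurable A -> nu ((D `\` [set` s]) `&` A) = 0%E.
  by move=> mA; apply: nus; [exact: measurableI|move=> x [[]]].
have [[mP _] [mN _] _ _] := nuPN.
have pos0 : jordan_pos nuPN (D `\` [set` s]) = 0%E.
  rewrite jordan_posE /charge.cjordan_pos /= /crestr0 mem_set//.
  exact: nu0.
have neg0 : jordan_neg nuPN (D `\` [set` s]) = 0%E.
  rewrite jordan_negE /charge.cjordan_neg /= /cscale /= /crestr0 mem_set//.
  by rewrite [crestr _ _ _]nu0// mule0.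
rewrite /Rintegral !(integral_carried_by_seq us mD sD mf)//.
have m1 (x : R) : measurable [set x] by exact: measurable_set1.
have finE (mu : {finite_measure set R -> \bar R}) :
    fine (\sum_(x <- s) (f x)%:E * mu [set x])%E = \sum_(x <- s) f x * fine (mu [set x]).
  rewrite -[RHS]/(fine (\sum_(x <- s) f x * fine (mu [set x]))%:E) -sumEFin.
  congr fine; apply: eq_bigr => x _.
  by rewrite EFinM fineK// fin_num_measure.
rewrite !finE -sumrB; apply: eq_bigr => x _.
have -> : fine (nu [set x]) =
    fine (jordan_pos nuPN [set x]) - fine (jordan_neg nuPN [set x]).
  rewrite (jordan_decomp nuPN (m1 x)).
  rewrite -[LHS]/(fine (jordan_pos nuPN [set x] + (-1)%:E * jordan_neg nuPN [set x])).
  by rewrite mulN1e fineB// fin_num_measure.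
by rewrite mulrBl mulrC (mulrC (f x)).
Qed.

(** * Total variation and complex combinations of Dirac masses *)

Lemma normcD_pair (R : realType) (a b c d : R) :
  normc ((a + c) +i* (b + d)) <= normc (a +i* b) + normc (c +i* d).
Proof. exact: (@le_normcD R (a +i* b) (c +i* d)). Qed.

Lemma normc_ge0 (R : realType) (z : R[i]) : 0 <= normc z.
Proof. by case: z => a b; apply: sqrtr_ge0. Qed.

Lemma normc_sqr (R : realType) (a b : R) : normc (a +i* b) ^+ 2 = a ^+ 2 + b ^+ 2.
Proof. by rewrite /= sqr_sqrtr// addr_ge0// sqr_ge0. Qed.

Lemma normc_sum_le (R : realType) (n : nat) (a b e : 'I_n -> R) :
  (forall k, 0 <= e k) ->
  normc ((\sum_k a k * e k) +i* (\sum_k b k * e k)) <=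
  \sum_k normc (a k +i* b k) * e k.
Proof.
move=> e0; elim/big_rec3 : _ => [|k x y z _ IH]; first by rewrite normc0.
apply: le_trans (normcD_pair _ _ _ _) (lerD _ IH).
rewrite -[X in _ <= _ * X]ger0_norm// -sqrtr_sqr -sqrtrM ?addr_ge0 ?sqr_ge0//=.
by rewrite mulrDl -!exprMn.
Qed.

Lemma variation_ge (R : realType) (mu : cmeasure R) (B : set R) (n : nat)
    (A : 'I_n -> set R) :
  (forall i, measurable (A i)) -> trivIset setT A -> \bigcup_i A i = B ->
  ((\sum_(i < n) normc (cval mu (A i)))%:E <= variation mu B)%E.
Proof. by move=> mA tA AB; apply: ereal_sup_ubound; exists n, A. Qed.

Lemma variation_ge_cval (R : realType) (mu : cmeasure R) (A B : set R) :
  measurable A -> measurable B -> A `<=` B ->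
  ((normc (cval mu A))%:E <= variation mu B)%E.
Proof.
move=> mA mB AB; pose F (i : 'I_2) := if i == ord0 then A else B `\` A.
have FB : \bigcup_i F i = B.
  apply/seteqP; split=> [x [i _]|x Bx].
    by rewrite /F; case: ifP => _; [exact: AB|case].
  have [Ax|nAx] := pselect (A x); first by exists ord0.
  by exists ord_max.
have tF : trivIset setT F.
  apply/trivIsetP => i j _ _ ij.
  rewrite /F; case: ifPn => [i0|i0]; case: ifPn => [j0|j0].
  - by rewrite (eqP i0) (eqP j0) eqxx in ij.
  - by rewrite setDIK.
  - by rewrite setIC setDIK.
  - case: i j ij i0 j0 => [[|[|i]]//= hi] [[|[|j]]//= hj].
have mF i : measurable (F i).
  by rewrite /F; case: ifP => _ //; exact: measurableD.
apply: le_trans (variation_ge mu mF tF FB).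
by rewrite lee_fin big_ord_recl /= lerDl sumr_ge0// => i _; exact: normc_ge0.
Qed.

(** The singletons, with the complement of [s] as last cell, partition the line. *)
Lemma tv_norm_ge_atoms (R : realType) (mu : cmeasure R) (s : seq R) : uniq s ->
  ((\sum_(x <- s) normc (cval mu [set x]))%:E <= tv_norm mu)%E.
Proof.
move=> us.
pose F (i : 'I_(size s).+1) := if (i < size s)%N then [set s`_i] else ~` [set` s].
have mF i : measurable (F i).
  rewrite /F; case: ifP => _; first exact: measurable_set1.
  by apply: measurableC; exact: measurable_seq.
have tF : trivIset setT F.
  apply/trivIsetP => i j _ _ ij; apply/seteqP; split=> // x [].
  rewrite /F; case: ifPn => i_s; case: ifPn => j_s //=.
  - by move=> -> /eqP; rewrite nth_uniq// => ij'; rewrite -val_eqE /= ij' in ij.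
  - by move=> ->; apply; exact: mem_nth.
  - by move=> /[swap] ->; apply; exact: mem_nth.
  - have := ltn_ord i; have := ltn_ord j; move: ij.
    by rewrite -val_eqE /=; lia.
have FT : \bigcup_i F i = setT.
  apply/seteqP; split=> // x _; have [xs|xs] := boolP (x \in s).
    have ix : (index x s < (size s).+1)%N by rewrite ltnS index_size.
    by exists (Ordinal ix) => //; rewrite /F /= index_mem xs /= nth_index.
  by exists ord_max => //; rewrite /F /= ltnn /=; exact/negP.
apply: le_trans (variation_ge mu mF tF FT).
rewrite lee_fin big_ord_recr /= (big_nth 0) big_mkord.
rewrite [X in _ <= X + _](eq_bigr (fun i : 'I_(size s) => normc (cval mu [set s`_i]))).
  by rewrite lerDl; exact: (normc_ge0 (cval mu (F ord_max))).
by move=> i _; rewrite /F /= ltn_ord.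
Qed.

Lemma sum_diracE (R : realType) (n : nat) (c t : 'I_n -> R) (A : set R) :
  sum_dirac c t A = (\sum_k c k * \1_A (t k))%:E.
Proof.
rewrite -[in RHS]big_enum /sum_dirac /=.
elim: (enum _) => [|k l IHl] /=; first by rewrite big_nil.
by rewrite big_cons /cadd /= IHl /cscale /= /charge_of_finite_measure /dirac.
Qed.

(** Cartesian weights: [spike_train] has this form by conversion, and so do the competitors used
    against the BLASSO solution. *)
Definition discrete_cmeasure (R : realType) (n : nat) (a b t : 'I_n -> R) :=
  CMeasure (sum_dirac a t) (sum_dirac b t).

(** Each point lies in at most one cell of a partition, so after exchanging the sums each weight
    counts at most once. Points may coincide, hence only an inequality. *)
Lemma tv_norm_discrete_le (R : realType) (n : nat) (a b t : 'I_n -> R) :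
  (tv_norm (discrete_cmeasure a b t) <= (\sum_k normc (a k +i* b k))%:E)%E.
Proof.
apply: ge_ereal_sup => _ [p [A [mA tA _ ->]]]; rewrite lee_fin.
have leA i : normc (cval (discrete_cmeasure a b t) (A i)) <=
    \sum_k normc (a k +i* b k) * \1_(A i) (t k).
  by rewrite /cval !sum_diracE; apply: normc_sum_le => k; rewrite indicE.
apply: le_trans (ler_sum _ (fun i _ => leA i)) _.
rewrite exchange_big /=; apply: ler_sum => k _.
rewrite -mulr_sumr ler_piMr ?normc_ge0//.
have [[i Ai]|nA] := pselect (exists i, A i (t k)); last first.
  rewrite big1// => i _; rewrite indicE memNset// => Ai.
  by apply: nA; exists i.
rewrite (bigD1 i)//= big1 ?addr0 ?indicE; first by case: (_ \in _).
move=> j ji; rewrite indicE memNset// => Aj.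
have : (A i `&` A j) (t k) by [].
by move/trivIsetP : tA => -> //; rewrite eq_sym.
Qed.

Lemma vanishes_outside_discrete (R : realType) (n : nat) (a b t : 'I_n -> R)
    (D : set R) : measurable D -> (forall k, D (t k)) ->
  vanishes_outside (discrete_cmeasure a b t) D.
Proof.
move=> mD Dt; apply/eqP; rewrite eq_le; apply/andP; split; last first.
  have mDC : measurable (~` D) by exact: measurableC.
  have AA : (~` D : set R) `<=` ~` D by [].
  apply: le_trans (variation_ge_cval _ mDC mDC AA).
  by rewrite lee_fin normc_ge0.
apply: ge_ereal_sup => _ [p [A [mA tA AD ->]]]; rewrite lee_fin.
rewrite big1// => i _; rewrite /cval !sum_diracE.
have t0 k : \1_(A i) (t k) = 0 :> R.
  rewrite indicE memNset// => Ai.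
  have : (~` D) (t k) by rewrite -AD; exists i.
  by apply; exact: Dt.
by rewrite !big1 ?normc0// => k _; rewrite t0 mulr0.
Qed.

Lemma charge_integral_sum_dirac (R : realType) (n : nat) (c t : 'I_n -> R)
    (D : set R) (f : R -> R) :
  measurable D -> (forall k, D (t k)) -> measurable_fun D f ->
  charge_integral (sum_dirac c t) D f = \sum_k c k * f (t k).
Proof.
(* Points may repeat: [undup] lists each location once, and the weights there add up. *)
move=> mD Dt mf; pose s := undup (codom t).
have ts k : t k \in s by rewrite mem_undup codom_f.
rewrite (@charge_integral_carried _ _ s)//; last 3 first.
- exact: undup_uniq.
- by move=> x; rewrite mem_undup => /codomP[k ->]; rewrite inE.
- move=> A mA As; rewrite sum_diracE big1// => k _.
  rewrite indicE memNset ?mulr0// => /As; apply; exact: ts.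
under eq_bigr do rewrite sum_diracE /= mulr_suml.
rewrite exchange_big /=; apply: eq_bigr => k _.
rewrite (bigD1_seq (t k))//= ?undup_uniq// big1 ?addr0 => [|x xk].
  by rewrite indicE mem_set// mulr1.
by rewrite indicE memNset ?mulr0 ?mul0r//= => /esym/eqP; rewrite (negPf xk).
Qed.

Lemma cheb_moments_discrete (R : realType) (m n : nat) (a b t : 'I_n -> R)
    (k : 'I_m.+1) : (forall i, unit_segment (t i)) ->
  cheb_moments (discrete_cmeasure a b t) k =
  (\sum_i a i * cheb k (t i)) +i* (\sum_i b i * cheb k (t i)).
Proof.
move=> Dt; have mD := @measurable_unit_segment R.
have mk := @measurable_fun_cheb R k.
by rewrite /cheb_moments /cintegral /= !charge_integral_sum_dirac.
Qed.

Lemma vanishes_outside_charge (R : realType) (mu : cmeasure R) (D A : set R) :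
  vanishes_outside mu D -> measurable D -> measurable A -> A `<=` ~` D ->
  cm_re mu A = 0%E /\ cm_im mu A = 0%E.
Proof.
move=> mu0 mD mA AD; have mDC : measurable (~` D) by exact: measurableC.
have := variation_ge_cval mu mA mDC AD; rewrite mu0 lee_fin => le0.
have /eq0_normc/eqP : normc (cval mu A) = 0.
  by apply/eqP; rewrite eq_le le0 normc_ge0.
rewrite /cval eq_complex /= => /andP[/eqP re0 /eqP im0].
by split; rewrite -[LHS]fineK ?fin_num_measure// ?re0 ?im0.
Qed.

(** The finite carrier is cut down to [D]. A set avoiding the result splits into a piece off the
    carrier and a piece off [D], both null. *)
Lemma finitely_atomic_carried (R : realType) (mu : cmeasure R) (D : set R) :
  measurable D -> vanishes_outside mu D -> finitely_atomic mu ->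
  exists s : seq R, [/\ uniq s, {subset s <= D},
    charge_carried (cm_re mu) s & charge_carried (cm_im mu) s].
Proof.
move=> mD muD [F /finite_seqP[s0 ->] mus0].
pose s := [seq x <- undup s0 | x \in D].
have carried A : measurable A -> A `<=` ~` [set` s] ->
    cm_re mu A = 0%E /\ cm_im mu A = 0%E.
  move=> mA As; have ms0 := measurable_seq s0.
  have [re1 im1] : cm_re mu (A `\` [set` s0]) = 0%E /\
                   cm_im mu (A `\` [set` s0]) = 0%E.
    have sub : A `\` [set` s0] `<=` ~` [set` s0] by move=> x [].
    by apply: (vanishes_outside_charge mus0 ms0 _ sub); exact: measurableD.
  have [re2 im2] : cm_re mu (A `&` [set` s0]) = 0%E /\
                   cm_im mu (A `&` [set` s0]) = 0%E.
    have sub : A `&` [set` s0] `<=` ~` D.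
      move=> x [/As xs /= xs0] Dx; apply: xs.
      by rewrite /= mem_filter mem_undup xs0 andbT inE.
    by apply: (vanishes_outside_charge muD mD _ sub); exact: measurableI.
  by split; rewrite (chargeDI _ mA ms0) ?re1 ?re2 ?im1 ?im2 adde0.
exists s; split.
- by rewrite filter_uniq// undup_uniq.
- by move=> x; rewrite mem_filter => /andP[].
- by move=> A mA /carried[].
- by move=> A mA /carried[].
Qed.

Lemma cheb_moments_carried (R : realType) (m : nat) (mu : cmeasure R) (s : seq R)
    (k : 'I_m.+1) : uniq s -> {subset s <= @unit_segment R} ->
  charge_carried (cm_re mu) s -> charge_carried (cm_im mu) s ->
  cheb_moments mu k =
  (\sum_(x <- s) fine (cm_re mu [set x]) * cheb k x) +i*
  (\sum_(x <- s) fine (cm_im mu [set x]) * cheb k x).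
Proof.
move=> us sD re_s im_s; have mD := @measurable_unit_segment R.
have mk := @measurable_fun_cheb R k.
by rewrite /cheb_moments /cintegral; congr (_ +i* _); apply: charge_integral_carried.
Qed.

Lemma atom_in_msupport (R : realType) (mu : cmeasure R) (x : R) :
  0 < normc (cval mu [set x]) -> msupport mu x.
Proof.
move=> mux U oU Ux; apply: lt_le_trans (variation_ge_cval _ (measurable_set1 x) _ _).
- by rewrite lte_fin.
- exact: open_measurable.
- by move=> _ ->.
Qed.

(** * Gaussian noise *)

Lemma measurable_normr_gt (R : realType) (u : R) :
  measurable [set x : R | u < `|x|].
Proof.
rewrite (_ : [set _ | _] = ~` [set x | `|x| <= u]); last first.
  by apply/seteqP; split=> x /=; [move=> /lt_geF ->|rewrite ltNge => /negP].
apply: measurableC.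
rewrite (_ : [set _ | _] = `[-u, u]%classic); first exact: measurable_itv.
by apply/seteqP; split=> x; rewrite /= in_itv /= ler_norml.
Qed.

Lemma normal_peak_double (R : realType) (sigma : R) :
  normal_peak (2 * sigma) = normal_peak sigma / 2.
Proof.
rewrite /normal_peak.
have sqrt4 y : Num.sqrt (2 ^+ 2 * y) = 2 * Num.sqrt y :> R.
  by rewrite (sqrtrM y (sqr_ge0 (2 : R))) sqrtr_sqr (ger0_norm (ler0n R 2)).
have sqrE : (2 * sigma) ^+ 2 * pi *+ 2 = 2 ^+ 2 * (sigma ^+ 2 * pi *+ 2) :> R.
  by rewrite exprMn -mulrA mulrnAr.
by rewrite sqrE (sqrt4 (sigma ^+ 2 * pi *+ 2)) invfM mulrC.
Qed.

(* Past [u] the density of standard deviation [sigma] is dominated by the one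
   of standard deviation [2 sigma], which integrates to [1]. *)
Lemma normal_tail (R : realType) (sigma u : R) : 0 < sigma -> 0 <= u ->
  (normal_prob 0 sigma [set x | (u < `|x|)%R] <=
   (2 * expR (- (3 / 8 * (u ^+ 2 / sigma ^+ 2))))%:E)%E.
Proof.
move=> sigma0 u0; set c := 2 * _.
have c0 : 0 <= c by rewrite mulr_ge0// expR_ge0.
pose V : set R := [set x | u < `|x|].
have mV : measurable V by exact: measurable_normr_gt.
have mpdf s : measurable_fun V (fun x => (normal_pdf 0 s x : R)%:E).
  by apply/measurable_EFinP; apply: measurable_funTS; exact: measurable_normal_pdf.
(* The exponents differ by [(1/2 - 1/8) x^2 / sigma^2], whence [3 / 8]; the factor 2 is the ratio of
   the peaks. *)
have pdf_le x : V x -> normal_pdf 0 sigma x <= c * normal_pdf 0 (2 * sigma) x.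
  rewrite /V /= => ux.
  have s0 : sigma != 0 by rewrite lt0r_neq0.
  have s20 : 2 * sigma != 0 by rewrite mulf_neq0.
  rewrite !normal_pdfE// normal_peak_double /normal_fun !subr0.
  move: (normal_peak sigma) (normal_peak_ge0 sigma) => p p0.
  rewrite (_ : c * _ = p * (expR (- (3 / 8 * (u ^+ 2 / sigma ^+ 2))) *
     expR (- x ^+ 2 / ((2 * sigma) ^+ 2 *+ 2)))); last first.
    by rewrite /c; field.
  rewrite ler_wpM2l// -expRD ler_expR.
  have x2 : u ^+ 2 <= x ^+ 2.
    by rewrite -(real_normK (num_real x)) ler_pXn2r ?nnegrE// ltW.
  have := ler_wpM2r (_ : 0 <= (sigma ^+ 2)^-1) x2.
  rewrite invr_ge0 sqr_ge0 => /(_ isT) h.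
  rewrite (_ : - x ^+ 2 / (sigma ^+ 2 *+ 2) = - (x ^+ 2 / sigma ^+ 2) / 2); last first.
    by rewrite -mulr_natr; field.
  rewrite (_ : - x ^+ 2 / ((2 * sigma) ^+ 2 *+ 2) = - (x ^+ 2 / sigma ^+ 2) / 8).
    lra.
  by rewrite -mulr_natr; field.
rewrite /normal_prob.
have pdf_ge0 s x : V x -> (0 <= (normal_pdf 0 s x : R)%:E)%E.
  by move=> _; rewrite lee_fin normal_pdf_ge0.
apply: le_trans (@ge0_le_integral _ _ _ lebesgue_measure V mV _
  (fun x => (c * normal_pdf 0 (2 * sigma) x)%:E) (pdf_ge0 sigma) (mpdf sigma) _ _) _.
- apply/measurable_EFinP; apply: measurable_funM => //.
  by apply: measurable_funTS; exact: measurable_normal_pdf.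
- by move=> x Vx; rewrite lee_fin; exact: pdf_le.
have cE : (0 <= c%:E)%E by rewrite lee_fin.
have := @ge0_integralZl _ _ _ lebesgue_measure V mV _ (mpdf (2 * sigma)) c%:E
  (pdf_ge0 _) cE.
rewrite /= => ->.
rewrite -[leRHS]mule1; apply: lee_wpmul2l; first by rewrite lee_fin.
rewrite -(integral_normal_pdf 0 (2 * sigma)).
apply: ge0_subset_integral => //.
- by apply/measurable_EFinP; exact: measurable_normal_pdf.
- by move=> x _; rewrite lee_fin normal_pdf_ge0.
Qed.

(** [exp (- 1/2) >= 1/2] gives [e <= 4], which is below 9. *)
Lemma ln_nat_ge1 (R : realType) (m : nat) : (9 <= m)%N -> 1 <= ln m%:R :> R.
Proof.
move=> m9; have m0 : (0 : R) < m%:R by rewrite ltr0n; lia.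
rewrite -ler_expR lnK ?posrE//.
have : 1 + - 2^-1 <= expR (- 2^-1) :> R by exact: expR_ge1Dx.
have e2 : expR 1 = expR (2^-1) ^+ 2 :> R.
  by rewrite -expRM_natl; congr expR; field.
have : expR (2^-1) * expR (- 2^-1) = 1 :> R by rewrite -expRD subrr expR0.
have : 0 < expR (2^-1) :> R by exact: expR_gt0.
have : 9 <= m%:R :> R by rewrite ler_nat.
rewrite e2; move: (expR _) (expR _) => a b; nra.
Qed.

(* Each coordinate is at most [lambda / sqrt (m + 1)], by a union bound. *)
Lemma small_noise_event (R : realType) (d : measure_display)
    (Omega : measurableType d) (Pr : probability Omega R) (m : nat)
    (sigma lambda : R) (eps : 'I_m.+1 -> {RV Pr >-> R}) :
  (9 <= m)%N -> 0 < sigma -> iid_gaussian sigma eps ->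
  lambda_M m sigma <= lambda ->
  exists E : set Omega,
    [/\ measurable E,
        ((1 - 8 * (lambda / lambda_M m sigma) * Num.sqrt (ln m%:R)
              * expR (- ((2 * (lambda ^+ 2 / lambda_M m sigma ^+ 2) - 1)
                         * ln m%:R)))%:E < Pr E)%E &
        forall w, E w -> \sum_k eps k w ^+ 2 <= lambda ^+ 2].
Proof.
move=> m9 sigma0 [_ gauss] le_lambda.
set L := ln m%:R; have L1 : 1 <= L := ln_nat_ge1 R m9.
have L0 : 0 < L := lt_le_trans ltr01 L1.
have m0 : (0 : R) < m%:R by rewrite ltr0n; lia.
have mR9 : (9 : R) <= m%:R by rewrite ler_nat.
have m1 : (0 : R) < m.+1%:R by rewrite ltr0n.
have L0' : 0 <= L := ltW L0.
have lM2 : lambda_M m sigma ^+ 2 = sigma ^+ 2 * (6 * m%:R * L).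
  by rewrite /lambda_M exprMn sqr_sqrtr// mulr_ge0// mulr_ge0.
have lM0 : 0 < lambda_M m sigma.
  by rewrite mulr_gt0// sqrtr_gt0 mulr_gt0// mulr_gt0.
have l0 : 0 < lambda := lt_le_trans lM0 le_lambda.
set r := lambda / lambda_M m sigma; have r1 : 1 <= r by rewrite ler_pdivlMr// mul1r.
have r2E : lambda ^+ 2 / lambda_M m sigma ^+ 2 = r ^+ 2 by rewrite /r expr_div_n.
rewrite r2E.
pose u := lambda / Num.sqrt m.+1%:R.
have u0 : 0 <= u by rewrite divr_ge0 ?sqrtr_ge0 ?ltW.
have u2 : u ^+ 2 = lambda ^+ 2 / m.+1%:R by rewrite expr_div_n sqr_sqrtr ?ltW.
pose V : set R := [set x | u < `|x|].
have mV : measurable V by exact: measurable_normr_gt.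
pose A (k : nat) := eps (inord k) @^-1` V.
have mA k : measurable (A k) by exact: measurable_funPTI.
pose B := \big[setU/set0]_(k < m.+1) A k.
have mB : measurable B by apply: bigsetU_measurable => k _.
(* The tail exponent is [9/4 * m / (m + 1)] times [r^2 * L], and [9/4 * m / (m + 1) >= 2] because
   [m >= 9]. *)
pose p := 2 * expR (- (2 * r ^+ 2 * L)).
have PA k : (Pr (A k) <= p%:E)%E.
  rewrite -[Pr (A k)]/(distribution Pr (eps (inord k)) V) gauss//.
  apply: le_trans (normal_tail sigma0 u0) _.
  rewrite lee_fin ler_wpM2l// ler_expR lerN2 u2.
  have -> : 3 / 8 * (lambda ^+ 2 / m.+1%:R / sigma ^+ 2) =
            r ^+ 2 * L * (9 / 4 * (m%:R / m.+1%:R)) :> R.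
    have -> : lambda ^+ 2 = r ^+ 2 * (sigma ^+ 2 * (6 * m%:R * L)).
      by rewrite -lM2 -r2E divfK// lt0r_neq0// exprn_gt0.
    by field; rewrite nat1r !lt0r_neq0.
  have rL0 : 0 <= r ^+ 2 * L by rewrite mulr_ge0// sqr_ge0.
  have q2 : 2 <= 9 / 4 * (m%:R / m.+1%:R) :> R.
    by rewrite mulrA ler_pdivlMr// -natr1; lra.
  have -> : 2 * r ^+ 2 * L = r ^+ 2 * L * 2 by ring.
  exact: ler_wpM2l.
exists (~` B); split; first exact: measurableC.
- have PB : (Pr B <= (m.+1%:R * p)%:E)%E.
    apply: le_trans (@Boole_inequality _ _ _ Pr A m.+1 (fun k _ => mA k)) _.
    apply: (@le_trans _ _ (\sum_(k < m.+1) p%:E)%E).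
      by apply: lee_sum => k _; exact: PA.
    by rewrite sumEFin lee_fin sumr_const card_ord mulr_natl.
  rewrite probability_setC//.
  apply: (@lt_le_trans _ _ (1 - m.+1%:R * p)%:E); last first.
    by rewrite EFinB; apply: leeB.
  rewrite lte_fin ltrD2l ltrN2.
  (* Splitting off [exp L = m] reduces the claim to [2 (m + 1) < 8 r sqrt(L) m], true since
     [r sqrt(L) >= 1]. *)
  have -> : - ((2 * r ^+ 2 - 1) * L) = - (2 * r ^+ 2 * L) + L by ring.
  rewrite expRD [expR L]lnK ?posrE// /p.
  have e0 : 0 < expR (- (2 * r ^+ 2 * L)) by exact: expR_gt0.
  have sL : 1 <= Num.sqrt L by rewrite -sqrtr1 ler_sqrt//; lra.
  have rL : 1 <= r * Num.sqrt L by rewrite -[1]mulr1 ler_pM.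
  rewrite -natr1; move: (expR _) e0 => e e0.
  have : 0 < e * (8 * (r * Num.sqrt L) * m%:R - 2 * (m%:R + 1)).
    by apply: mulr_gt0 => //; have := ler_wpM2r (ltW m0) rL; lra.
  by rewrite -subr_gt0; congr (0 < _); ring.
- move=> w nBw; have le_u k : `|eps k w| <= u.
    rewrite leNgt; apply/negP => uk; apply: nBw.
    rewrite /B -bigcup_mkord; exists k => //=.
    by rewrite /A /V /= inord_val.
  have le_u2 k : eps k w ^+ 2 <= lambda ^+ 2 / m.+1%:R.
    by rewrite -u2 -(real_normK (num_real (eps k w))) ler_pXn2r ?nnegrE.
  apply: le_trans (ler_sum _ (fun k _ => le_u2 k)) _.
  rewrite sumr_const card_ord -[X in X <= _]mulr_natr divfK//.
Qed.

(** * Optimality of the BLASSO solution *)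

(* A list of triples [(a, b, t)] stands for the measure [\sum (a + i b) \d_t]. *)
Definition list_moment (R : realType) (m : nat) (l : seq (R * R * R))
    (c : R * R * R -> R) (k : 'I_m.+1) : R :=
  \sum_(p <- l) c p * cheb k p.2.

Definition atoms (R : realType) (mu : cmeasure R) (s : seq R) : seq (R * R * R) :=
  [seq (fine (cm_re mu [set x]), fine (cm_im mu [set x]), x) | x <- s].

Local Notation re3 := (fun p => p.1.1).
Local Notation im3 := (fun p => p.1.2).

(** The penalty is the sum of the moduli: it is at least the total variation, with equality when the
    points are distinct. *)
Definition list_objective (R : realType) (m : nat) (yr yi : 'I_m.+1 -> R)
    (lambda : R) (l : seq (R * R * R)) : R :=
  2^-1 * (\sum_k ((list_moment l re3 k - yr k) ^+ 2 +
                  (list_moment l im3 k - yi k) ^+ 2)) +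
  lambda * \sum_(p <- l) normc (p.1.1 +i* p.1.2).

Lemma normc_subr_sqr (R : realType) (a b c d : R) :
  normc ((a +i* b) - (c +i* d)) ^+ 2 = (a - c) ^+ 2 + (b - d) ^+ 2.
Proof. by rewrite -normc_sqr. Qed.

(** Reduction to finite lists: the mass of the atoms is at most the total variation of the solution,
    and that of a competitor is at most its sum of moduli. *)
Lemma blasso_solution_atoms (R : realType) (m : nat) (yr yi : 'I_m.+1 -> R)
    (lambda : R) (nu : cmeasure R) (s : seq R) (l : seq (R * R * R)) :
  0 <= lambda -> blasso_solution (fun k => yr k +i* yi k) lambda nu ->
  uniq s -> {subset s <= @unit_segment R} ->
  charge_carried (cm_re nu) s -> charge_carried (cm_im nu) s ->
  (forall p, p \in l -> unit_segment p.2) ->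
  list_objective yr yi lambda (atoms nu s) <= list_objective yr yi lambda l.
Proof.
move=> lambda0 [_ nu_min] us sD re_s im_s lD.
pose L := in_tuple l; pose a i := (tnth L i).1.1; pose b i := (tnth L i).1.2.
pose t i := (tnth L i).2.
have tD i : unit_segment (t i) by apply: lD; exact: mem_tnth.
have mD := @measurable_unit_segment R.
have := nu_min _ (vanishes_outside_discrete a b mD tD).
rewrite /blasso_objective => le_obj.
have lam0 : (0 <= lambda%:E)%E by rewrite lee_fin.
rewrite -lee_fin /list_objective !EFinD.
apply: le_trans (le_trans _ le_obj) _; apply: leeD.
- rewrite lee_fin le_eqVlt; apply/orP; left; apply/eqP; congr (_ * _).
  apply: eq_bigr => k _; rewrite (cheb_moments_carried k us sD re_s im_s).
  by rewrite normc_subr_sqr /list_moment /atoms !big_map.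
- rewrite EFinM; apply: lee_wpmul2l => //.
  by rewrite /atoms big_map; exact: tv_norm_ge_atoms.
- rewrite lee_fin le_eqVlt; apply/orP; left; apply/eqP; congr (_ * _).
  apply: eq_bigr => k _; rewrite cheb_moments_discrete//.
  by rewrite normc_subr_sqr /list_moment !(big_tnth _ _ l).
- rewrite [leRHS]EFinM; apply: lee_wpmul2l => //.
  by rewrite (big_tnth _ _ l); exact: tv_norm_discrete_le.
Qed.

(* First-order optimality: test against the solution plus a small multiple of
   the residual's value at [x], placed at [x]. *)
Lemma blasso_kkt (R : realType) (m : nat) (yr yi : 'I_m.+1 -> R)
    (lambda : R) (l : seq (R * R * R)) (x : R) :
  0 <= lambda -> unit_segment x -> (forall p, p \in l -> unit_segment p.2) ->
  (forall l', (forall p, p \in l' -> unit_segment p.2) ->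
    list_objective yr yi lambda l <= list_objective yr yi lambda l') ->
  (\sum_k (yr k - list_moment l re3 k) * cheb k x) ^+ 2 +
  (\sum_k (yi k - list_moment l im3 k) * cheb k x) ^+ 2 <= lambda ^+ 2.
Proof.
move=> lambda0 xD lD l_min.
pose rho k := yr k - list_moment l re3 k.
pose eta k := yi k - list_moment l im3 k.
set G := \sum_k rho k * cheb k x; set H := \sum_k eta k * cheb k x.
pose N := normc (G +i* H); pose Phi := \sum_(k < m.+1) cheb k x ^+ 2.
have N2 : N ^+ 2 = G ^+ 2 + H ^+ 2 by exact: normc_sqr.
have N0 : 0 <= N by exact: normc_ge0.
have Phi0 : 0 <= Phi by apply: sumr_ge0 => k _; exact: sqr_ge0.
rewrite -N2 ler_pXn2r ?nnegrE// leNgt; apply/negP => ltN.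
have GH : G * G + H * H = \sum_k (G * rho k + H * eta k) * cheb k x.
  rewrite {2}/G {2}/H !mulr_sumr -big_split /=.
  by apply: eq_bigr => k _; ring.
clearbody G H.
have tau_ineq tau : 0 <= tau ->
    0 <= tau * (lambda * N - N ^+ 2 + tau * (N ^+ 2 * Phi / 2)).
  move=> tau0; have := l_min ((tau * G, tau * H, x) :: l).
  have lD' p : p \in (tau * G, tau * H, x) :: l -> unit_segment p.2.
    by rewrite inE => /orP[/eqP->|/lD].
  move=> /(_ lD'); rewrite /list_objective big_cons /=.
  have -> : Num.sqrt ((tau * G) ^+ 2 + (tau * H) ^+ 2) = tau * N.
    by rewrite !exprMn -mulrDr sqrtrM ?sqr_ge0// sqrtr_sqr ger0_norm.
  have -> : \sum_(k < m.+1)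
      ((list_moment ((tau * G, tau * H, x) :: l) re3 k - yr k) ^+ 2 +
       (list_moment ((tau * G, tau * H, x) :: l) im3 k - yi k) ^+ 2) =
    \sum_k ((list_moment l re3 k - yr k) ^+ 2 +
            (list_moment l im3 k - yi k) ^+ 2) +
    (- (2 * tau * (G * G + H * H)) + tau ^+ 2 * N ^+ 2 * Phi).
    rewrite GH /Phi !mulr_sumr -sumrN -!big_split /=; apply: eq_bigr => k _.
    rewrite N2.
    by rewrite /rho /eta /list_moment !big_cons /=; ring.
  rewrite -!expr2 -N2; lra.
have Q0 : 0 < N ^+ 2 * Phi + 1 by rewrite ltr_wpDl// mulr_ge0// sqr_ge0.
have gap : 0 < N * (N - lambda) by rewrite mulr_gt0 ?subr_gt0// (le_lt_trans lambda0).
(* Small enough for the linear gain [N (N - lambda)] to beat the quadratic cost; the [+ 1] keeps the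
   denominator positive. *)
pose tau := N * (N - lambda) / (N ^+ 2 * Phi + 1).
have tau0 : 0 < tau by rewrite divr_gt0.
have := tau_ineq tau (ltW tau0); rewrite pmulr_rge0//.
have tauE : tau * (N ^+ 2 * Phi + 1) = N * (N - lambda) by rewrite /tau divfK// lt0r_neq0.
lra.
Qed.

(** * Testing against polynomials *)

Definition cheb_eval (R : realType) (m : nat) (A : 'I_m.+1 -> R) (x : R) : R :=
  \sum_k A k * cheb k x.

(** Passes between coefficients, where Euclidean norms are controlled, and points, where the
    isolation condition applies. *)
Lemma sum_list_moment (R : realType) (m : nat) (A : 'I_m.+1 -> R)
    (l : seq (R * R * R)) (c : R * R * R -> R) :
  \sum_k A k * list_moment l c k = \sum_(p <- l) c p * cheb_eval A p.2.
Proof.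
rewrite /list_moment /cheb_eval.
under eq_bigr do rewrite mulr_sumr.
rewrite exchange_big /=; apply: eq_bigr => p _.
by rewrite mulr_sumr; apply: eq_bigr => k _; ring.
Qed.

Definition spikes (R : realType) (s : nat) (amp theta tau : 'I_s -> R) :
    seq (R * R * R) :=
  [seq (amp j * cos (theta j), amp j * sin (theta j), tau j) | j <- enum 'I_s].

Lemma sum_spikes (R : realType) (s : nat) (amp theta tau : 'I_s -> R)
    (F : R * R * R -> R) :
  \sum_(p <- spikes amp theta tau) F p =
  \sum_j F (amp j * cos (theta j), amp j * sin (theta j), tau j).
Proof. by rewrite /spikes big_map big_enum. Qed.

(** The left-hand side is the real part of the product. *)
Lemma normc_dot_le (R : realType) (a b c d : R) :
  a * c - b * d <= normc (a +i* b) * normc (c +i* d).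
Proof.
rewrite -normcM; set z := (_ +i* _) * _.
have -> : a * c - b * d = complex.Re z by [].
case: z => u v /=; apply: le_trans (ler_norm u) _.
by rewrite -sqrtr_sqr ler_wsqrtr// lerDl sqr_ge0.
Qed.


(** Since [A + i B] takes the value [exp (- i theta j)] at [tau j], its pairing with the target is
    the mass of the target, while its pairing with [l] is at most the mass weighted by its modulus.
    Comparing objectives leaves only quadratic terms in the noise and the residual. *)
Lemma bregman_le (R : realType) (m s : nat) (amp theta tau : 'I_s -> R)
    (eps A B yr yi : 'I_m.+1 -> R) (lambda : R) (l : seq (R * R * R)) :
  0 <= lambda ->
  (forall j, 0 <= amp j) ->
  (forall k, yr k = list_moment (spikes amp theta tau) re3 k + eps k) ->
  (forall k, yi k = list_moment (spikes amp theta tau) im3 k) ->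
  list_objective yr yi lambda l <=
    list_objective yr yi lambda (spikes amp theta tau) ->
  \sum_k eps k ^+ 2 <= lambda ^+ 2 ->
  \sum_k (A k ^+ 2 + B k ^+ 2) <= 1 ->
  (forall j, cheb_eval A (tau j) = cos (theta j)) ->
  (forall j, cheb_eval B (tau j) = - sin (theta j)) ->
  lambda * (\sum_(p <- l) normc (p.1.1 +i* p.1.2) *
     (1 - normc (cheb_eval A p.2 +i* cheb_eval B p.2))) <= 2 * lambda ^+ 2.
Proof.
move=> lambda0 amp0 yrE yiE; rewrite /list_objective => l_le eps_le AB_le A_tau B_tau.
set M := list_moment (spikes amp theta tau) in yrE yiE l_le.
have massE : \sum_(p <- spikes amp theta tau) normc (p.1.1 +i* p.1.2) =
    \sum_k (A k * M re3 k - B k * M im3 k).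
  rewrite sumrB !sum_list_moment -sumrB !sum_spikes; apply: eq_bigr => j _ /=.
  rewrite A_tau B_tau !exprMn -mulrDr cos2Dsin2 mulr1 sqrtr_sqr ger0_norm//.
  have := cos2Dsin2 (theta j); move: (cos _) (sin _) => c e ce.
  by rewrite -[LHS]mulr1 -ce; ring.
rewrite massE in l_le.
have dual_le : \sum_k (A k * list_moment l re3 k - B k * list_moment l im3 k) <=
    \sum_(p <- l) normc (p.1.1 +i* p.1.2) * normc (cheb_eval A p.2 +i* cheb_eval B p.2).
  rewrite sumrB !sum_list_moment -sumrB; apply: ler_sum => p _.
  exact: normc_dot_le.
have -> : \sum_(p <- l) normc (p.1.1 +i* p.1.2) *
     (1 - normc (cheb_eval A p.2 +i* cheb_eval B p.2)) =
   \sum_(p <- l) normc (p.1.1 +i* p.1.2) - \sum_(p <- l) normc (p.1.1 +i* p.1.2) *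
       normc (cheb_eval A p.2 +i* cheb_eval B p.2).
  by rewrite -sumrB; apply: eq_bigr => p _; rewrite mulrBr mulr1.
have noiseE : \sum_k ((M re3 k - yr k) ^+ 2 + (M im3 k - yi k) ^+ 2) =
    \sum_k eps k ^+ 2.
  by apply: eq_bigr => k _; rewrite yrE yiE; ring.
rewrite noiseE in l_le.
have dual_le' := ler_wpM2l lambda0 dual_le.
(* Coefficient by coefficient, the right-hand side minus the left is half the sum of the four
   squares displayed below. *)
have termwise :
  2^-1 * (\sum_k eps k ^+ 2)
  - 2^-1 * (\sum_k ((list_moment l re3 k - yr k) ^+ 2 + (list_moment l im3 k - yi k) ^+ 2))
  + lambda * (\sum_k (A k * M re3 k - B k * M im3 k))
  - lambda * (\sum_k (A k * list_moment l re3 k - B k * list_moment l im3 k))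
  <= \sum_k eps k ^+ 2 + lambda ^+ 2 * (\sum_k (A k ^+ 2 + B k ^+ 2)).
  rewrite !mulr_sumr -!sumrN -!big_split /=; apply: ler_sum => k _.
  rewrite yrE yiE; move: (list_moment l _ _) (list_moment l _ _) (M _ _) (M _ _).
  move=> W U Y X; rewrite -subr_ge0.
  set e := eps k; set a := A k; set b := B k.
  have : 0 <= 2^-1 * (U - X - (e - lambda * a)) ^+ 2 +
     2^-1 * (W - Y - lambda * b) ^+ 2 + 2^-1 * (e + lambda * a) ^+ 2 +
     2^-1 * (lambda * b) ^+ 2.
    by rewrite !addr_ge0// mulr_ge0// sqr_ge0.
  by congr (0 <= _); field.
have := ler_wpM2l (sqr_ge0 lambda) AB_le; rewrite mulr1 => AB_le'.
lra.
Qed.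

(* With [Q (tau l)] equal to [0] except at [l = j], the test against [Q] sees
   only the [j]-th spike; the moment defect is bounded through the noise and
   the residual. *)
Lemma amp_le_dual_test (R : realType) (m s : nat) (amp theta tau : 'I_s -> R)
    (eps Q yr yi : 'I_m.+1 -> R) (lambda : R) (l : seq (R * R * R)) (j : 'I_s) :
  0 < lambda ->
  (forall k, yr k = list_moment (spikes amp theta tau) re3 k + eps k) ->
  (forall k, yi k = list_moment (spikes amp theta tau) im3 k) ->
  \sum_k eps k ^+ 2 <= lambda ^+ 2 ->
  \sum_k ((yr k - list_moment l re3 k) ^+ 2 +
          (yi k - list_moment l im3 k) ^+ 2) <= lambda ^+ 2 ->
  \sum_k Q k ^+ 2 <= 1 ->
  (forall i, cheb_eval Q (tau i) = (i == j)%:R) ->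
  amp j <= 2 * lambda +
    \sum_(p <- l) normc (p.1.1 +i* p.1.2) * `|cheb_eval Q p.2|.
Proof.
move=> lambda0 yrE yiE eps_le res_le Q_le Q_tau.
set M := list_moment (spikes amp theta tau) in yrE yiE.
(* Rotating by [exp (- i theta j)] makes the [j]-th spike real and positive. *)
pose c := cos (theta j); pose e := sin (theta j).
have ce : c ^+ 2 + e ^+ 2 = 1 by exact: cos2Dsin2.
have spikeE : \sum_k Q k * (c * M re3 k + e * M im3 k) = amp j.
  transitivity (c * (\sum_k Q k * M re3 k) + e * (\sum_k Q k * M im3 k)).
    rewrite !mulr_sumr -big_split /=; apply: eq_bigr => k _; ring.
  have pick (F : 'I_s -> R) : \sum_i F i * cheb_eval Q (tau i) = F j.
    rewrite (bigD1 j)//= Q_tau eqxx mulr1 big1 ?addr0// => i ij.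
    by rewrite Q_tau (negPf ij) mulr0.
  rewrite !sum_list_moment !sum_spikes /= !pick -/c -/e -[RHS]mulr1 -ce.
  by ring.
have testE : \sum_k Q k * (c * list_moment l re3 k + e * list_moment l im3 k) <=
    \sum_(p <- l) normc (p.1.1 +i* p.1.2) * `|cheb_eval Q p.2|.
  rewrite (_ : \sum_k _ = c * (\sum_k Q k * list_moment l re3 k) +
      e * (\sum_k Q k * list_moment l im3 k)); last first.
    rewrite !mulr_sumr -big_split /=; apply: eq_bigr => k _; ring.
  rewrite !sum_list_moment !mulr_sumr -big_split /=; apply: ler_sum => p _.
  have -> : c * (p.1.1 * cheb_eval Q p.2) + e * (p.1.2 * cheb_eval Q p.2) =
    p.1.1 * (c * cheb_eval Q p.2) - p.1.2 * (- e * cheb_eval Q p.2) by ring.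
  apply: le_trans (normc_dot_le _ _ _ _) _.
  rewrite ler_wpM2l ?sqrtr_ge0//= !exprMn sqrrN -mulrDl ce mul1r.
  by rewrite sqrtr_sqr.
(* Young's inequality scaled by [4 * lambda]; the moment difference is noise minus residual, so its
   square is at most twice the sum of the two squares. The total is [(4 + 2 + 2) * lambda^2]. *)
have defect : 4 * lambda * (\sum_k Q k * (c * M re3 k + e * M im3 k)
    - \sum_k Q k * (c * list_moment l re3 k + e * list_moment l im3 k)) <=
  4 * lambda ^+ 2 * (\sum_k Q k ^+ 2) + 2 * (\sum_k eps k ^+ 2) +
  2 * (\sum_k ((yr k - list_moment l re3 k) ^+ 2 + (yi k - list_moment l im3 k) ^+ 2)).
  rewrite -sumrB !mulr_sumr -!big_split /=; apply: ler_sum => k _.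
  rewrite yrE yiE; move: (list_moment l _ _) (list_moment l _ _) (M _ _) (M _ _).
  move=> W U Y X; set q := Q k; set n := eps k.
  pose u := U - X; pose v := W - Y.
  have CS : (c * u + e * v) ^+ 2 <= u ^+ 2 + v ^+ 2.
    rewrite -subr_ge0 (_ : _ - _ = (e * u - c * v) ^+ 2) ?sqr_ge0//.
    by rewrite -[u ^+ 2 + _]mul1r -ce; ring.
  have h1 : 0 <= (2 * lambda * q + (c * u + e * v)) ^+ 2 by exact: sqr_ge0.
  have h2 : 0 <= (n + (n - u)) ^+ 2 by exact: sqr_ge0.
  rewrite /u /v in CS h1 h2.
  have h3 : 0 <= (W - Y) ^+ 2 by exact: sqr_ge0.
  lra.
have Q_le' := ler_wpM2l (_ : 0 <= 4 * lambda ^+ 2) Q_le.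
rewrite spikeE in defect.
have : 4 * lambda * (amp j -
     \sum_k Q k * (c * list_moment l re3 k + e * list_moment l im3 k)) <=
     4 * lambda * (2 * lambda).
  by have := Q_le' ltac:(by rewrite mulr_ge0// sqr_ge0); lra.
rewrite ler_pM2l ?mulr_gt0//; lra.
Qed.

(** * The quadratic isolation condition *)

Definition qic_weight (R : realType) (m s : nat) (tau : 'I_s -> R) (Ca Cb x : R) : R :=
  \big[Num.min/Cb]_(k < s) Num.min (Ca * m%:R ^+ 2 * `|x - tau k| ^+ 2) Cb.

Lemma qic_weight_cases (R : realType) (m s : nat) (tau : 'I_s -> R) (Ca Cb x : R) :
  qic_weight m tau Ca Cb x = Cb \/
  exists2 k, qic_weight m tau Ca Cb x = Ca * m%:R ^+ 2 * (x - tau k) ^+ 2 &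
             qic_weight m tau Ca Cb x < Cb.
Proof.
rewrite /qic_weight; apply: (big_ind (fun v => v = Cb \/
  exists2 k, v = Ca * m%:R ^+ 2 * (x - tau k) ^+ 2 & v < Cb)).
- by left.
- by move=> v w Kv Kw; rewrite /Num.min; case: ifP => _.
- move=> k _; rewrite real_normK ?num_real//.
  by rewrite /Num.min; case: ltP => lt_Cb; [right; exists k|left].
Qed.

Lemma le_qic_weight (R : realType) (m s : nat) (tau : 'I_s -> R) (Ca Cb x c : R) :
  c <= Cb -> (forall k, c <= Ca * m%:R ^+ 2 * (x - tau k) ^+ 2) ->
  c <= qic_weight m tau Ca Cb x.
Proof.
move=> cCb ck; rewrite /qic_weight; apply: (big_ind (fun v => c <= v)) => //.
  by move=> v w cv cw; rewrite le_min cv.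
by move=> k _; rewrite le_min cCb real_normK ?num_real// ck.
Qed.

Lemma cheb_span_eval (R : realType) (m : nat) (P : R -> R[i]) : cheb_span m P ->
  exists A B : 'I_m.+1 -> R, forall x, P x = cheb_eval A x +i* cheb_eval B x.
Proof.
move=> [a ->]; exists (fun k => complex.Re (a k)), (fun k => complex.Im (a k)) => x.
rewrite /cheb_eval; elim/big_rec3 : _ => [|k u v w _ ->] //.
by case: (a k) => b c; rewrite /= ; simpc.
Qed.

(** The angles [0] and [pi] prescribe signs, and the real part of the polynomial keeps these values
    without increasing the modulus. *)
Lemma QIC_real (R : realType) (m s : nat) (tau : 'I_s -> R) (Ca Cb : R)
    (sg : 'I_s -> bool) : QIC m tau Ca Cb ->
  exists A : 'I_m.+1 -> R, (forall k, cheb_eval A (tau k) = (-1) ^+ sg k) /\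
    forall x, unit_segment x -> `|cheb_eval A x| <= 1 - qic_weight m tau Ca Cb x.
Proof.
move=> [_ _ _ /(_ (fun k => (sg k)%:R * pi))[P [spanP P_tau P_le]]].
have [A [B PE]] := cheb_span_eval spanP; exists A; split=> [k|x xD].
  have := P_tau k; rewrite PE /expi => -[-> _].
  by rewrite cosN cos_npi.
have := P_le x xD; rewrite PE -/(qic_weight m tau Ca Cb x) => le1.
have : `|cheb_eval A x| <= normc (cheb_eval A x +i* cheb_eval B x).
  by rewrite -sqrtr_sqr ler_wsqrtr// lerDl sqr_ge0.
by lra.
Qed.

Lemma qic_weight_ge0 (R : realType) (m s : nat) (tau : 'I_s -> R) (Ca Cb x : R) :
  0 < Ca -> 0 < Cb -> 0 <= qic_weight m tau Ca Cb x.
Proof.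
move=> Ca0 Cb0; apply: le_qic_weight => [|k]; first exact: ltW.
by apply: mulr_ge0 (sqr_ge0 _); apply: mulr_ge0 (sqr_ge0 _); exact: ltW.
Qed.

(** Of the factors [1 - x] and [1 + x], one is at least 1 and the other at least [c]. *)
Lemma subr1_sqr_ge (R : realType) (c x : R) :
  0 <= c -> c <= 1 - x -> c <= 1 + x -> c <= 1 - x ^+ 2.
Proof. by move=> c0 xr xl; have [x0|/ltW x0] := leP 0 x; nra. Qed.

(** The two gaps add up to 2, whence [c0 <= 1/2]. *)
Lemma qic_endpoint_gap (R : realType) (s : nat) (tau : 'I_s -> R) (c0 : R) (k : 'I_s) :
  unit_segment (tau k) ->
  2 * c0 <= `|tau k - 1| /\ 2 * c0 <= `|tau k - (-1)| ->
  [/\ 2 * c0 <= 1 - tau k, 2 * c0 <= 1 + tau k & c0 <= 2^-1].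
Proof.
move=> /andP[tl tr]; rewrite opprK ler0_norm ?subr_le0// ger0_norm; last by lra.
by move=> [hr hl]; split; lra.
Qed.

(* Opposite signs prescribed at two points force them apart. *)
Lemma qic_separation (R : realType) (m s : nat) (tau : 'I_s -> R) (c0 Ca Cb : R)
    (k l : 'I_s) :
  0 < c0 -> (forall k, unit_segment (tau k)) ->
  (forall k, 2 * c0 <= `|tau k - 1| /\ 2 * c0 <= `|tau k - (-1)|) ->
  QIC m tau Ca Cb -> k != l ->
  8 * c0 ^+ 2 <= m%:R ^+ 2 * (tau k - tau l) ^+ 2.
Proof.
move=> c00 tauD gap qic kl; have [Ca0 Cb0 _ _] := qic.
have [A [A_tau A_le]] := QIC_real (fun i => i == k) qic.
have [gkr gkl c0_le] := qic_endpoint_gap (tauD k) (gap k).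
have [glr gll _] := qic_endpoint_gap (tauD l) (gap l).
have c20 : 0 < 2 * c0 by rewrite mulr_gt0.
have A_le1 z : unit_segment z -> `|\sum_i A i * cheb i z| <= 1.
  move=> zD; apply: le_trans (A_le z zD) _.
  by rewrite lerBlDr lerDl qic_weight_ge0.
have Al : \sum_i A i * cheb i (tau l) = 1.
  by have := A_tau l; rewrite eq_sym (negPf kl).
have := cheb_sum_near_max A_le1 Al c20
  (subr1_sqr_ge (ltW c20) glr gll) (subr1_sqr_ge (ltW c20) gkr gkl).
(* The drop from 1 to -1 yields [4 * c0] on the left, and [8 * c0^2 <= 4 * c0] as [c0 <= 1/2]. *)
rewrite -/(cheb_eval A _) A_tau eqxx expr1; nra.
Qed.

(** Two such points would satisfy [m^2 (tau k - tau l)^2 <= 4 c0^2], against the separation bound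
    [8 c0^2]. *)
Lemma qic_nearest_unique (R : realType) (m s : nat) (tau : 'I_s -> R)
    (c0 Ca Cb x : R) (k l : 'I_s) :
  0 < c0 -> (forall k, unit_segment (tau k)) ->
  (forall k, 2 * c0 <= `|tau k - 1| /\ 2 * c0 <= `|tau k - (-1)|) ->
  QIC m tau Ca Cb ->
  m%:R * `|x - tau k| <= c0 -> m%:R * `|x - tau l| <= c0 -> k = l.
Proof.
move=> c00 tauD gap qic xk xl; apply/eqP; apply/negPn/negP => kl.
have := qic_separation c00 tauD gap qic kl.
have : m%:R * `|tau k - tau l| <= 2 * c0.
  have : `|tau k - tau l| <= `|x - tau k| + `|x - tau l|.
    by rewrite -(normrN (x - tau k)) opprB; apply: le_trans (ler_normD _ _); rewrite subrKA.
  by move=> /(ler_wpM2l (ler0n R m)); lra.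
rewrite -(real_normK (num_real (tau k - tau l))) -exprMn.
have : 0 <= m%:R * `|tau k - tau l| by rewrite mulr_ge0.
move: (m%:R * _) => v; nra.
Qed.

(** At distance [dlt] from [tau k] the quadratic term reaches [Cb], so the polynomial equal to 1 on
    the support has dropped by [Cb]. The estimate near a maximum then gives
    [c0 * Cb <= Cb / Ca <= c0^2], that is [Cb <= c0 <= 1/2]. *)
Lemma qic_Cb_le (R : realType) (m s : nat) (tau : 'I_s -> R) (c0 Ca Cb : R)
    (k : 'I_s) :
  (2 <= m)%N -> 0 < c0 -> (forall k, unit_segment (tau k)) ->
  (forall k, 2 * c0 <= `|tau k - 1| /\ 2 * c0 <= `|tau k - (-1)|) ->
  QIC m tau Ca Cb -> Cb / Ca <= c0 ^+ 2 -> Cb <= 2^-1.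
Proof.
move=> m2 c00 tauD gap qic CbCa; have [Ca0 Cb0 _ _] := qic.
have [A [A_tau A_le]] := QIC_real (fun=> false) qic.
have [gkr gkl c0_le] := qic_endpoint_gap (tauD k) (gap k).
have m0 : (0 : R) < m%:R by rewrite ltr0n; lia.
have mR2 : (2 : R) <= m%:R by rewrite ler_nat.
pose dlt := Num.sqrt (Cb / Ca) / m%:R.
have CbCa0 : 0 <= Cb / Ca by rewrite divr_ge0 ?ltW.
have dlt0 : 0 <= dlt by rewrite divr_ge0 ?sqrtr_ge0 ?ltW.
have mdlt2 : m%:R ^+ 2 * dlt ^+ 2 = Cb / Ca.
  by rewrite -exprMn mulrC divfK ?sqr_sqrtr// lt0r_neq0.
have mdlt : m%:R * dlt <= c0.
  by rewrite mulrC divfK ?lt0r_neq0// -(ger0_norm (ltW c00)) -sqrtr_sqr ler_wsqrtr.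
have dlt_le : dlt <= c0 by nra.
pose x := tau k + dlt.
have [xr xl] : c0 <= 1 - x /\ c0 <= 1 + x by rewrite /x; split; lra.
have xD : unit_segment x by apply/andP; split; lra.
have wx : Cb <= qic_weight m tau Ca Cb x.
  apply: le_qic_weight => // l; rewrite -mulrA -ler_pdivrMl// mulrC -mdlt2.
  have [->|kl] := eqVneq l k; first by rewrite /x addrAC subrr add0r.
  (* The scaled separation exceeds twice the scaled [dlt], so no other support point is closer to
     [x] than [tau k]. *)
  have := qic_separation c00 tauD gap qic kl.
  have -> : x - tau l = dlt - (tau l - tau k) by rewrite /x; ring.
  have e0 : 0 <= m%:R * dlt by rewrite mulr_ge0// ltW.
  rewrite -!exprMn [m%:R * (dlt - _)]mulrBr.
  move: (m%:R * dlt) e0 mdlt => e e0 ec.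
  move: (m%:R * _) => v v2; rewrite -subr_ge0.
  have -> : (e - v) ^+ 2 - e ^+ 2 = v * (v - 2 * e) by ring.
  have [v0|v0] := leP v 0; first by nra.
  have : 2 * e <= v by nra.
  by move=> ev; rewrite mulr_ge0 ?subr_ge0// ltW.
have A_le1 z : unit_segment z -> `|\sum_i A i * cheb i z| <= 1.
  move=> zD; apply: le_trans (A_le z zD) _.
  by rewrite lerBlDr lerDl qic_weight_ge0.
have Ak : \sum_i A i * cheb i (tau k) = 1 by have := A_tau k; rewrite expr0.
have tr : c0 <= 1 - tau k by lra.
have tl : c0 <= 1 + tau k by lra.
have := cheb_sum_near_max A_le1 Ak c00
  (subr1_sqr_ge (ltW c00) tr tl) (subr1_sqr_ge (ltW c00) xr xl).
have := A_le x xD; rewrite ler_norml -/(cheb_eval A x) => /andP[_ Ax].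
rewrite (_ : x - tau k = dlt) ?mdlt2; last by rewrite /x; ring.
move=> h; have : c0 * Cb <= c0 ^+ 2 by nra.
by rewrite expr2 ler_pM2l//; lra.
Qed.

(* Near [tau k] the two polynomials are close to their extreme values [1] and
   [-1], so that they nearly cancel. *)
Lemma qic_cancellation (R : realType) (m s : nat) (tau : 'I_s -> R)
    (c0 Ca Cb x : R) (A B : 'I_m.+1 -> R) (k : 'I_s) :
  (2 <= m)%N -> 0 < c0 -> (forall k, unit_segment (tau k)) ->
  (forall k, 2 * c0 <= `|tau k - 1| /\ 2 * c0 <= `|tau k - (-1)|) ->
  QIC m tau Ca Cb -> Cb / Ca <= c0 ^+ 2 ->
  (forall z, unit_segment z -> `|cheb_eval A z| <= 1) ->
  (forall z, unit_segment z -> `|cheb_eval B z| <= 1) ->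
  cheb_eval A (tau k) = 1 -> cheb_eval B (tau k) = -1 ->
  Ca * m%:R ^+ 2 * (x - tau k) ^+ 2 < Cb ->
  `|cheb_eval A x + cheb_eval B x| / 2 <=
    (1 - Cb) / Cb * (Ca * m%:R ^+ 2 * (x - tau k) ^+ 2).
Proof.
move=> m2 c00 tauD gap qic CbCa A_le B_le Ak Bk near_k.
have [Ca0 Cb0 _ _] := qic.
have Cb_le := qic_Cb_le k m2 c00 tauD gap qic CbCa.
have [gkr gkl c0_le] := qic_endpoint_gap (tauD k) (gap k).
have m0 : (0 : R) < m%:R by rewrite ltr0n; lia.
have mR2 : (2 : R) <= m%:R by rewrite ler_nat.
pose D := m%:R ^+ 2 * (x - tau k) ^+ 2.
have D0 : 0 <= D by rewrite mulr_ge0 ?sqr_ge0.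
have near_k' : Ca * D < Cb by rewrite /D mulrA.
have CbCa' : Cb <= c0 ^+ 2 * Ca by rewrite -ler_pdivrMr.
have D_le : D <= c0 ^+ 2 by nra.
have xk : `|x - tau k| <= c0.
  have : `|x - tau k| ^+ 2 <= c0 ^+ 2.
    rewrite real_normK ?num_real//; apply: le_trans D_le.
    by rewrite /D ler_peMl ?sqr_ge0//; nra.
  by rewrite ler_pXn2r ?nnegrE ?(ltW c00).
have /andP[xkl xkr] : - c0 <= x - tau k <= c0 by rewrite -ler_norml.
have [xr xl] : c0 <= 1 - x /\ c0 <= 1 + x by split; lra.
have xD : unit_segment x by apply/andP; split; lra.
have tr : c0 <= 1 - tau k by lra.
have tl : c0 <= 1 + tau k by lra.
have c1 := subr1_sqr_ge (ltW c00) tr tl.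
have c2 := subr1_sqr_ge (ltW c00) xr xl.
have hA : c0 * (1 - cheb_eval A x) <= D by exact: (cheb_sum_near_max A_le Ak c00 c1 c2).
(* Negating [B] turns its minimum -1 at [tau k] into a maximum 1. *)
pose NB k := - B k.
have NBE z : cheb_eval NB z = - cheb_eval B z.
  by rewrite /cheb_eval -sumrN; apply: eq_bigr => i _; rewrite mulNr.
have hB : c0 * (1 - cheb_eval NB x) <= D.
  apply: (cheb_sum_near_max _ _ c00 c1 c2) => [z zD|].
    by rewrite -/(cheb_eval NB z) NBE normrN; exact: B_le.
  by rewrite -/(cheb_eval NB _) NBE Bk opprK.
rewrite NBE opprK in hB.
have := A_le x xD; rewrite ler_norml => /andP[_ A1].
have := B_le x xD; rewrite ler_norml => /andP[B1 _].
(* [A - 1 <= 0 <= B + 1] add up to [A + B], so a single bound [D] suffices. *)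
have le_D : c0 * `|cheb_eval A x + cheb_eval B x| <= D.
  have A1' : 0 <= c0 * (1 - cheb_eval A x) by rewrite mulr_ge0 ?subr_ge0// ltW.
  have B1' : 0 <= c0 * (1 + cheb_eval B x).
    by rewrite mulr_ge0 ?(ltW c00)//; lra.
  have [h|h] := leP 0 (cheb_eval A x + cheb_eval B x).
    by rewrite (ger0_norm h); lra.
  by rewrite (ltr0_norm h); lra.
rewrite mulrAC ler_pdivlMr// -mulrA -/D.
move: (`|_|) (normr_ge0 (cheb_eval A x + cheb_eval B x)) le_D => v v0 le_D.
have CaD0 : 0 <= Ca * D by apply: mulr_ge0 => //; exact: ltW.
have c0Ca : 0 <= c0 * Ca by apply: mulr_ge0; exact: ltW.
(* [Cb <= c0^2 * Ca] absorbs the loss [1 / c0]; the leftover [c0 <= 1/2] is at most [1 - Cb]. *)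
have h1 : v * Cb <= c0 * Ca * D.
  apply: le_trans (ler_wpM2l v0 CbCa') _.
  have := ler_wpM2l c0Ca le_D.
  by rewrite (_ : c0 * Ca * (c0 * v) = v * (c0 ^+ 2 * Ca)); [|ring].
have h2 := ler_wpM2r CaD0 c0_le.
have h3 : 2^-1 * (Ca * D) <= (1 - Cb) * (Ca * D).
  by rewrite (ler_wpM2r CaD0)//; lra.
lra.
Qed.

(** * Localization of the atoms and of the spikes *)

Lemma cheb_eval_sqr_sum_le1 (R : realType) (m : nat) (Q : 'I_m.+1 -> R) :
  (forall x, unit_segment x -> `|cheb_eval Q x| <= 1) -> \sum_k Q k ^+ 2 <= 1.
Proof.
move=> Q_le; have := @cheb_parseval_le R m Q (fun=> 0) 1.
have -> : \sum_k (Q k ^+ 2 + 0 ^+ 2) = \sum_k Q k ^+ 2.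
  by apply: eq_bigr => k _; rewrite expr0n addr0.
apply=> x xD; rewrite [X in _ + X ^+ 2]big1 => [|k _]; last by rewrite mul0r.
by rewrite expr0n addr0 -(real_normK (num_real _)) expr_le1// Q_le.
Qed.

(** The polynomial given by the isolation condition for the phases of the target serves as dual
    certificate: it is bounded by 1, hence so is the norm of its coefficients, and [1 - |P|]
    dominates the weight. *)
Lemma qic_mass_le (R : realType) (m s : nat) (amp theta tau : 'I_s -> R)
    (eps yr yi : 'I_m.+1 -> R) (Ca Cb lambda : R) (l : seq (R * R * R)) :
  0 < lambda -> (forall j, 0 <= amp j) -> QIC m tau Ca Cb ->
  (forall k, yr k = list_moment (spikes amp theta tau) re3 k + eps k) ->
  (forall k, yi k = list_moment (spikes amp theta tau) im3 k) ->
  list_objective yr yi lambda l <=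
    list_objective yr yi lambda (spikes amp theta tau) ->
  \sum_k eps k ^+ 2 <= lambda ^+ 2 ->
  (forall p, p \in l -> unit_segment p.2) ->
  \sum_(p <- l) normc (p.1.1 +i* p.1.2) * qic_weight m tau Ca Cb p.2 <= 2 * lambda.
Proof.
move=> lambda0 amp0 qic yrE yiE l_le eps_le lD; have [Ca0 Cb0 _ /(_ theta)] := qic.
move=> [P [/cheb_span_eval[A [B PE]] P_tau P_le]].
have P_norm x : unit_segment x ->
    normc (cheb_eval A x +i* cheb_eval B x) <= 1 - qic_weight m tau Ca Cb x.
  by move=> xD; have := P_le x xD; rewrite PE -/(qic_weight m tau Ca Cb x); lra.
have AB_le : \sum_k (A k ^+ 2 + B k ^+ 2) <= 1.
  apply: cheb_parseval_le => x xD; rewrite -normc_sqr expr_le1 ?normc_ge0//.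
  by apply: le_trans (P_norm x xD) _; rewrite gerBl qic_weight_ge0.
have A_tau j : cheb_eval A (tau j) = cos (theta j).
  by have := P_tau j; rewrite PE => -[-> _]; rewrite cosN.
have B_tau j : cheb_eval B (tau j) = - sin (theta j).
  by have := P_tau j; rewrite PE => -[_ ->]; rewrite sinN.
have := bregman_le (ltW lambda0) amp0 yrE yiE l_le eps_le AB_le A_tau B_tau.
rewrite expr2 mulrCA ler_pM2l//; apply: le_trans.
rewrite big_seq [leRHS]big_seq; apply: ler_sum => p pl.
by rewrite ler_wpM2l ?normc_ge0//; have := P_norm _ (lD p pl); lra.
Qed.

Lemma norm_le_sqrt_div (R : realType) (m : nat) (K x : R) : (0 < m)%N ->
  m%:R ^+ 2 * x ^+ 2 <= K -> `|x| <= Num.sqrt K / m%:R.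
Proof.
move=> m0 le_K; rewrite ler_pdivlMr ?ltr0n// -(ger0_norm (ler0n R m)) -normrM.
by rewrite -sqrtr_sqr ler_wsqrtr// exprMn mulrC.
Qed.

(** A heavy atom must have weight below [Cb], so the weight is one of the quadratic terms, which
    bounds the distance. The radius is at most [c0 / m] because
    [2 lambda / (Ca W) <= Cb / Ca <= c0^2]. *)
Lemma atom_near_spike (R : realType) (m s : nat) (tau : 'I_s -> R)
    (c0 Ca Cb lambda W x : R) :
  (0 < m)%N -> 0 < c0 -> 0 < lambda ->
  (forall k, unit_segment (tau k)) ->
  (forall k, 2 * c0 <= `|tau k - 1| /\ 2 * c0 <= `|tau k - (-1)|) ->
  QIC m tau Ca Cb -> Cb / Ca <= c0 ^+ 2 ->
  2 * lambda / Cb < W -> W * qic_weight m tau Ca Cb x <= 2 * lambda ->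
  exists! t, range tau t /\
    `|x - t| <= Num.sqrt (2 * lambda / (Ca * W)) / m%:R <= c0 / m%:R.
Proof.
move=> m0 c00 lambda0 tauD gap qic CbCa ltW_ Ww; have [Ca0 Cb0 _ _] := qic.
have mR : (0 : R) < m%:R by rewrite ltr0n.
have W0 : 0 < W by apply: lt_trans ltW_; rewrite divr_gt0// mulr_gt0.
have lt2l : 2 * lambda < W * Cb by rewrite -ltr_pdivrMr.
have rad_le : Num.sqrt (2 * lambda / (Ca * W)) / m%:R <= c0 / m%:R.
  rewrite ler_wpM2r ?invr_ge0// -[leRHS](ger0_norm (ltW c00)) -sqrtr_sqr.
  rewrite ler_wsqrtr// (le_trans _ CbCa)// ler_pdivrMr ?mulr_gt0// mulrA divfK ?lt0r_neq0//.
  by rewrite (mulrC Cb) ltW.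
have [wE|[k wE wlt]] := qic_weight_cases m tau Ca Cb x.
  by move: Ww; rewrite wE; lra.
exists (tau k); split.
  split; first by exists k.
  rewrite rad_le andbT; apply: norm_le_sqrt_div => //.
  rewrite ler_pdivlMr ?mulr_gt0//; move: Ww; rewrite wE => Ww.
  by apply: le_trans Ww; rewrite le_eqVlt; apply/orP; left; apply/eqP; ring.
move=> _ [[l _ <-] /andP[xl _]]; congr tau.
have close i : `|x - tau i| <= Num.sqrt (2 * lambda / (Ca * W)) / m%:R ->
    m%:R * `|x - tau i| <= c0.
  by move=> /le_trans /(_ rad_le); rewrite ler_pdivlMr// mulrC.
apply: (qic_nearest_unique c00 tauD gap qic); apply: close => //.
apply: norm_le_sqrt_div => //.
rewrite ler_pdivlMr ?mulr_gt0//; move: Ww; rewrite wE => Ww.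
by apply: le_trans Ww; rewrite le_eqVlt; apply/orP; left; apply/eqP; ring.
Qed.

(** By contradiction: if every charged atom is farther than the radius, [|Q| <= K * w] at the
    charged atoms, so testing against [Q] gives [amp j <= 2 lambda + 2 lambda K], which is too
    small. *)
Lemma spike_near_atom (R : realType) (m s : nat) (amp theta tau : 'I_s -> R)
    (eps yr yi : 'I_m.+1 -> R) (c0 Ca Cb lambda : R) (l : seq (R * R * R))
    (j : 'I_s) :
  (2 <= m)%N -> 0 < c0 -> 0 < lambda ->
  (forall j, 0 <= amp j) ->
  (forall k, unit_segment (tau k)) ->
  (forall k, 2 * c0 <= `|tau k - 1| /\ 2 * c0 <= `|tau k - (-1)|) ->
  QIC m tau Ca Cb -> Cb / Ca <= c0 ^+ 2 ->
  (forall k, yr k = list_moment (spikes amp theta tau) re3 k + eps k) ->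
  (forall k, yi k = list_moment (spikes amp theta tau) im3 k) ->
  \sum_k eps k ^+ 2 <= lambda ^+ 2 ->
  (forall p, p \in l -> unit_segment p.2) ->
  (forall l', (forall p, p \in l' -> unit_segment p.2) ->
    list_objective yr yi lambda l <= list_objective yr yi lambda l') ->
  Cprime Ca Cb * lambda < amp j ->
  exists2 p, p \in l & 0 < normc (p.1.1 +i* p.1.2) /\
    `|tau j - p.2| <= Num.sqrt (2 * lambda / (Ca * (amp j - Cprime Ca Cb * lambda))) / m%:R.
Proof.
move=> m2 c00 lambda0 amp0 tauD gap qic CbCa yrE yiE eps_le lD l_min big_j.
have [Ca0 Cb0 Cb1 _] := qic; have m0 : (0 < m)%N by lia.
have mR : (0 : R) < m%:R by rewrite ltr0n.
set E := amp j - Cprime Ca Cb * lambda.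
have E0 : 0 < E by rewrite subr_gt0.
apply: contrapT => far.
have [A [A_tau A_le]] := QIC_real (fun=> false) qic.
have [B [B_tau B_le]] := QIC_real (fun i => i != j) qic.
pose w x := qic_weight m tau Ca Cb x.
have w0 x : 0 <= w x by exact: qic_weight_ge0.
have A_le1 z : unit_segment z -> `|cheb_eval A z| <= 1.
  by move=> zD; apply: le_trans (A_le z zD) _; rewrite gerBl w0.
have B_le1 z : unit_segment z -> `|cheb_eval B z| <= 1.
  by move=> zD; apply: le_trans (B_le z zD) _; rewrite gerBl w0.
pose Q k := (A k + B k) / 2.
have QE z : cheb_eval Q z = (cheb_eval A z + cheb_eval B z) / 2.
  rewrite /cheb_eval -big_split /= mulr_suml; apply: eq_bigr => k _.
  by rewrite /Q; ring.
have Q_norm z : `|cheb_eval Q z| = `|cheb_eval A z + cheb_eval B z| / 2.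
  by rewrite QE normrM [`|2^-1|]ger0_norm.
have Q_le z : unit_segment z -> `|cheb_eval Q z| <= 1 - w z.
  move=> zD; rewrite Q_norm ler_pdivrMr//; apply: le_trans (ler_normD _ _) _.
  by have := A_le z zD; have := B_le z zD; rewrite -/(w z); lra.
have Q_tau i : cheb_eval Q (tau i) = (i == j)%:R.
  rewrite QE A_tau B_tau expr0; case: eqVneq => _ /=; last by rewrite expr1; field.
  by rewrite expr0; field.
have Q_sum : \sum_k Q k ^+ 2 <= 1.
  apply: cheb_eval_sqr_sum_le1 => z zD; apply: le_trans (Q_le z zD) _.
  by rewrite gerBl.
have res_le : \sum_k ((yr k - list_moment l re3 k) ^+ 2 +
    (yi k - list_moment l im3 k) ^+ 2) <= lambda ^+ 2.
  by apply: cheb_parseval_le => x xD; apply: blasso_kkt => //; exact: ltW.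
have amp_le := amp_le_dual_test lambda0 yrE yiE eps_le res_le Q_sum Q_tau.
have spikesD p : p \in spikes amp theta tau -> unit_segment p.2.
  by move=> /mapP[i _ ->]; exact: tauD.
have mass := qic_mass_le lambda0 amp0 qic yrE yiE (l_min _ spikesD) eps_le lD.
(* The first entry serves atoms of weight [Cb] or close to another spike, the second those whose
   weight comes from [tau j]. *)
pose K := Num.max ((1 - Cb) / Cb) (E / (2 * lambda)).
have K1 : (1 - Cb) / Cb <= K by rewrite le_max lexx.
have K2 : E / (2 * lambda) <= K by rewrite le_max lexx orbT.
have frac0 : 0 < (1 - Cb) / Cb by rewrite divr_gt0 ?subr_gt0.
have K0 : 0 <= K by apply: le_trans K1; exact: ltW.
have Q_atom p : p \in l -> normc (p.1.1 +i* p.1.2) * `|cheb_eval Q p.2| <=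
    K * (normc (p.1.1 +i* p.1.2) * w p.2).
  move=> pl; have pD := lD p pl.
  have [n0|n0] := leP (normc (p.1.1 +i* p.1.2)) 0.
    have -> : normc (p.1.1 +i* p.1.2) = 0 by apply/eqP; rewrite eq_le n0 normc_ge0.
    by rewrite !mul0r mulr0.
  rewrite mulrCA ler_pM2l//.
  have [wE|[k wE wlt]] := qic_weight_cases m tau Ca Cb p.2.
    apply: le_trans (Q_le _ pD) _; rewrite /w wE.
    by rewrite -ler_pdivrMr.
  have [kj|kj] := eqVneq k j.
    (* Beyond the radius the weight exceeds [2 * lambda / E], so the trivial bound [|Q| <= 1] is
       enough. *)
    have farp : 2 * lambda / (Ca * E) < m%:R ^+ 2 * (p.2 - tau k) ^+ 2.
      rewrite ltNge; apply/negP => near; apply: far; exists p => //; split=> //.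
      by rewrite -kj distrC; apply: norm_le_sqrt_div.
    apply: (@le_trans _ _ 1).
      by apply: le_trans (Q_le _ pD) _; rewrite gerBl.
    apply: (@le_trans _ _ (E / (2 * lambda) * w p.2)); last by rewrite ler_wpM2r.
    rewrite mulrAC ler_pdivlMr ?mulr_gt0// mul1r /w wE.
    move: farp; rewrite ltr_pdivrMr ?mulr_gt0// => /ltW /le_trans; apply.
    by rewrite le_eqVlt; apply/orP; left; apply/eqP; ring.
  apply: (@le_trans _ _ ((1 - Cb) / Cb * w p.2)); last by rewrite ler_wpM2r.
  rewrite Q_norm /w wE; rewrite wE in wlt.
  apply: (qic_cancellation m2 c00 tauD gap qic CbCa A_le1 B_le1) => //.
  by rewrite B_tau kj expr1.
have : \sum_(p <- l) normc (p.1.1 +i* p.1.2) * `|cheb_eval Q p.2| <= K * (2 * lambda).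
  apply: le_trans (ler_wpM2l K0 mass).
  rewrite big_seq mulr_sumr [leRHS]big_seq; exact: ler_sum.
(* [Cprime] is at least [2 + 2 (1 - Cb) / Cb], and in particular exceeds 2. *)
have E_lt : E < amp j - 2 * lambda /\
    (1 - Cb) / Cb * (2 * lambda) < amp j - 2 * lambda.
  have : 2 * ((1 - Cb) / Cb) <= Cprime Ca Cb - 2.
    by rewrite /Cprime addrAC subrr add0r mulrA le_max lexx.
  move=> /(ler_wpM2r (ltW lambda0)); have := mulr_gt0 frac0 lambda0.
  by rewrite /E; move: ((1 - Cb) / Cb) (Cprime Ca Cb) big_j => a b; lra.
have : K * (2 * lambda) < amp j - 2 * lambda.
  rewrite /K; case: E_lt => E1 E2.
  by case: (leP ((1 - Cb) / Cb) (E / (2 * lambda))) => _ //; rewrite divfK// lt0r_neq0// mulr_gt0.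
lra.
Qed.

Theorem corollary2 (R : realType) (d : measure_display)
    (Omega : measurableType d) (Pr : probability Omega R)
    (m s : nat) (c0 Ca Cb sigma lambda : R) (amp theta tau : 'I_s -> R)
    (eps : 'I_m.+1 -> {RV Pr >-> R}) (Dhat : Omega -> cmeasure R)
    (y : Omega -> 'I_m.+1 -> R[i]) :
  (9 <= m)%N -> 0 < c0 ->
  (forall k, 0 < amp k) ->
  injective tau ->
  (forall k, unit_segment (tau k)) ->
  (forall k, 2 * c0 <= `|tau k - 1| /\ 2 * c0 <= `|tau k - (-1)|) ->
  QIC m tau Ca Cb -> Cb / Ca <= c0 ^+ 2 ->
  0 < sigma -> iid_gaussian sigma eps ->
  (forall w k,
     y w k = cheb_moments (spike_train amp theta tau) k + (eps k w)%:C) ->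
  lambda_M m sigma <= lambda ->
  (forall w, blasso_solution (y w) lambda (Dhat w)) ->
  (forall w, finitely_atomic (Dhat w)) ->
  exists E : set Omega,
    [/\ measurable E,
        ((1 - 8 * (lambda / lambda_M m sigma) * Num.sqrt (ln m%:R)
              * expR (- ((2 * (lambda ^+ 2 / lambda_M m sigma ^+ 2) - 1)
                         * ln m%:R)))%:E < Pr E)%E &
        forall w, E w ->
          (forall x, unit_segment x ->
             2 * lambda / Cb < normc (cval (Dhat w) [set x]) ->
             exists! t, range tau t /\
               `|x - t|
                 <= Num.sqrt (2 * lambda
                              / (Ca * normc (cval (Dhat w) [set x]))) / m%:R
                 <= c0 / m%:R) /\
          (forall j, Cprime Ca Cb * lambda < amp j ->
             exists2 t, msupport (Dhat w) t &
               `|tau j - t|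
                 <= Num.sqrt (2 * lambda
                              / (Ca * (amp j - Cprime Ca Cb * lambda)))
                    / m%:R)].
Proof.
move=> m9 c00 amp0 _ tauD gap qic CbCa sigma0 gauss yE lam_le sol atomic.
have [E [mE PE noise_le]] := small_noise_event m9 sigma0 gauss lam_le.
exists E; split=> // w Ew.
have lamM0 : 0 < lambda_M m sigma.
  have := ln_nat_ge1 R m9 => L1.
  have L0 : 0 < ln m%:R :> R by apply: lt_le_trans L1.
  have m0 : (0 : R) < m%:R by rewrite ltr0n; lia.
  by rewrite mulr_gt0// sqrtr_gt0 mulr_gt0// mulr_gt0.
have lambda0 : 0 < lambda by apply: lt_le_trans lam_le.
have amp0' j : 0 <= amp j by exact: ltW.
have [Ca0 Cb0 _ _] := qic.
pose yr (k : 'I_m.+1) : R := list_moment (spikes amp theta tau) re3 k + eps k w.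
pose yi (k : 'I_m.+1) : R := list_moment (spikes amp theta tau) im3 k.
have yw : y w = (fun k : 'I_m.+1 => yr k +i* yi k).
  apply/funext => k; rewrite yE.
  (* The noise is real, so it enters [yr] only. *)
  rewrite -[spike_train _ _ _]/(discrete_cmeasure (fun j => amp j * cos (theta j))
    (fun j => amp j * sin (theta j)) tau) cheb_moments_discrete//.
  by rewrite /yr /yi /list_moment !sum_spikes /=; simpc.
have [s0 [us sD re_s im_s]] := finitely_atomic_carried (@measurable_unit_segment R)
  (sol w).1 (atomic w).
set l := atoms (Dhat w) s0.
have solw := sol w; rewrite yw in solw.
have lD p : p \in l -> unit_segment p.2.
  by move=> /mapP[x xs ->]; have := sD x xs; rewrite inE.
have l_min l' : (forall p, p \in l' -> unit_segment p.2) ->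
    list_objective yr yi lambda l <= list_objective yr yi lambda l'.
  exact: (blasso_solution_atoms (ltW lambda0) solw us sD re_s im_s).
have spikesD p : p \in spikes amp theta tau -> unit_segment p.2.
  by move=> /mapP[i _ ->]; exact: tauD.
have yrE k : yr k = list_moment (spikes amp theta tau) re3 k + eps k w by [].
have yiE k : yi k = list_moment (spikes amp theta tau) im3 k by [].
split=> [x xD big_x|j big_j].
- apply: (atom_near_spike _ c00 lambda0 tauD gap qic CbCa big_x); first by lia.
  (* A point off the carrier has no mass, contrary to [big_x]. *)
  have xs : x \in s0.
    apply: contraT => xs; move: big_x.
    have sub : [set x] `<=` ~` [set` s0] by move=> _ ->; exact/negP.
    have mx := measurable_set1 x.
    rewrite /cval (re_s _ mx sub) (im_s _ mx sub) /= expr0n addr0 sqrtr0.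
    by rewrite ltNge => /negP[]; rewrite divr_ge0 ?mulr_ge0 ?ltW.
  have := qic_mass_le lambda0 amp0' qic yrE yiE (l_min _ spikesD) (noise_le w Ew) lD.
  (* All terms of the weighted mass are nonnegative; only the one at [x] is kept. *)
  apply: le_trans; rewrite /l /atoms big_map (bigD1_seq x)//=.
  rewrite lerDl; apply: sumr_ge0 => z _; apply: mulr_ge0; first exact: sqrtr_ge0.
  exact: qic_weight_ge0.
- have [|_ /mapP[x xs ->] [cx near_x]] := spike_near_atom _ c00 lambda0 amp0'
    tauD gap qic CbCa yrE yiE (noise_le w Ew) lD l_min big_j; first by lia.
  by exists x => //; exact: atom_in_msupport.
Qed.
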